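(* (1) Every recursive bounded sequence of real numbers contains a $low_2$ Cauchy subsequence (a subsequence converging but not necessarily fast). (2) There exists a recursive bounded sequence of real numbers containing no computable Cauchy subsequence. (3) There exists a recursive bounded sequence of real numbers containing no fast converging subsequence computable in $0'$.
   Context: A recursive sequence of reals is a sequence $(x_i)_{i\in\mathbb N}$ of uniformly computable real numbers (rational approximations to $x_i$ within $2^{-k}$ are computable from $i,k$). A subsequence is given by a strictly increasing index function $f:\mathbb N\to\mathbb N$; its computability properties are those of $f$. It is a Cauchy subsequence if $\forall n\,\exists s\,\forall v,w\ge s\ |x_{f(v)}-x_{f(w)}|<2^{-n}$ (no computability of $s$ from $n$ is required), and it is fast converging if $\forall n\,\forall v,w\ge n\ |x_{f(v)}-x_{f(w)}|<2^{-n}$. A Turing degree $d$ is $low_2$ if $d''=0''$, and a subsequence is $low_2$ if its index function $f$ has $low_2$ degree. $0'$ is the degree of the halting problem. *)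

(* Defs.v *)
From mathcomp Require Import all_boot all_order all_algebra.
From mathcomp Require Import all_classical all_reals all_analysis.
From Stdlib Require Cantor.

Set Implicit Arguments.
Unset Strict Implicit.
Unset Printing Implicit Defensive.

Import Order.TTheory GRing.Theory Num.Theory.
Import numFieldNormedType.Exports.
Local Open Scope ring_scope.

(* Cantor's bijection between nat * nat and nat, and its projections. *)
Definition pairn (m n : nat) : nat := Cantor.to_nat (m, n).
Definition fstn (n : nat) : nat := (Cantor.of_nat n).1.
Definition sndn (n : nat) : nat := (Cantor.of_nat n).2.

(* Kleene's partial recursive functions relative to an oracle, presented as
   unary functions: several arguments are passed through pairn.  A partial
   function is represented by its graph. *)
Inductive code : Type :=
| CZero | CSucc | CFst | CSnd | COracle
| CPair of code & code
| CComp of code & code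
| CPrec of code & code
| CMu of code.

(* h a 0 = F a  and  h a m.+1 = G <a, <m, h a m>> *)
Fixpoint prim_rec (F G : nat -> nat -> Prop) (a n y : nat) : Prop :=
  match n with
  | 0 => F a y
  | m.+1 => exists2 z, prim_rec F G a m z & G (pairn a (pairn m z)) y
  end.

(* The least y with F <x, y> = 0, F being defined at all smaller arguments. *)
Definition minimize (F : nat -> nat -> Prop) (x y : nat) : Prop :=
  F (pairn x y) 0%N /\
  forall m, (m < y)%N -> exists v, F (pairn x m) v.+1.

(* code_eval A c x y: program c with oracle A halts on input x with output y. *)
Fixpoint code_eval (A : nat -> nat) (c : code) (x y : nat) : Prop :=
  match c with
  | CZero => y = 0%N
  | CSucc => y = x.+1
  | CFst => y = fstn x
  | CSnd => y = sndn x
  | COracle => y = A x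
  | CPair c1 c2 => exists u v,
      [/\ code_eval A c1 x u, code_eval A c2 x v & y = pairn u v]
  | CComp c1 c2 => exists2 z, code_eval A c2 x z & code_eval A c1 z y
  | CPrec c1 c2 =>
      prim_rec (code_eval A c1) (code_eval A c2) (fstn x) (sndn x) y
  | CMu c1 => minimize (code_eval A c1) x y
  end.

(* Goedel numbering of programs. *)
Fixpoint encode (c : code) : nat :=
  match c with
  | CZero => pairn 0 0
  | CSucc => pairn 1 0
  | CFst => pairn 2 0
  | CSnd => pairn 3 0
  | COracle => pairn 4 0
  | CPair c1 c2 => pairn 5 (pairn (encode c1) (encode c2))
  | CComp c1 c2 => pairn 6 (pairn (encode c1) (encode c2))
  | CPrec c1 c2 => pairn 7 (pairn (encode c1) (encode c2))
  | CMu c1 => pairn 8 (encode c1)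
  end.

(* f is Turing reducible to A. *)
Definition computable_in (A f : nat -> nat) : Prop :=
  exists c, forall x, code_eval A c x (f x).

Definition turing_equiv (A B : nat -> nat) : Prop :=
  computable_in A B /\ computable_in B A.

(* A representative of the degree 0. *)
Definition zero_deg : nat -> nat := fun=> 0%N.

Definition computable (f : nat -> nat) : Prop := computable_in zero_deg f.

(* The characteristic function of { e | the e-th program with oracle A halts
   on input e }; an e that numbers no program counts as diverging. *)
Definition jump (A : nat -> nat) : nat -> nat :=
  fun e => `[< exists2 c, encode c = e & exists y, code_eval A c e y >].

Definition low2 (f : nat -> nat) : Prop :=
  turing_equiv (jump (jump f)) (jump (jump zero_deg)).

(* The number <a, <b, d>> names (a - b) / (d + 1): every rational has a name. *)
Definition rat_of_nat (n : nat) : rat :=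
  ((fstn n)%:R - (fstn (sndn n))%:R) / (sndn (sndn n)).+1%:R.

Definition recursive_seq (R : realType) (x : nat -> R) : Prop :=
  exists2 q : nat -> nat, computable q &
    forall i k, `|x i - ratr (rat_of_nat (q (pairn i k)))| <= 2 ^- k.

Definition cauchy_subseq (R : realType) (x : nat -> R) (f : nat -> nat) : Prop :=
  forall n : nat, exists s : nat, forall v w : nat, (s <= v)%N -> (s <= w)%N ->
    `|x (f v) - x (f w)| < 2 ^- n.

Definition fast_subseq (R : realType) (x : nat -> R) (f : nat -> nat) : Prop :=
  forall n v w : nat, (n <= v)%N -> (n <= w)%N ->
    `|x (f v) - x (f w)| < 2 ^- n.

(* Main.v *)
Require Import Defs.
From mathcomp Require Import all_boot all_order all_algebra.
From mathcomp Require Import all_classical all_reals all_analysis.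
From mathcomp Require Import zify ring lra.

Import numFieldNormedType.Exports.
Import Order.TTheory GRing.Theory Num.Theory.
Set Implicit Arguments.
Unset Strict Implicit.
Unset Printing Implicit Defensive.

(* (1) The sets R_<n,k> = {i : the 2^-n approximation of x_i is below the k-th
   rational} are uniformly computable, and since x is bounded, any f along which
   each R_m is eventually constant makes x o f Cauchy.  The 0-1 sequences X such
   that every cell {i : R_m(i) = X(m) for m < n} is infinite are the paths through
   an infinite 0'-computable binary tree, so the low basis theorem relative to 0'
   yields a path X with (X + 0')' <= 0''.  Mathias forcing inside the cells of X
   builds f with f' <= X + 0': whether a finite extension within the current cell
   makes the next program halt is a question for 0', and X tells which smaller
   cell to pass to.  Hence f'' <= (X + 0')' <= 0''.

   (2), (3) Let x_i have base 4 digits R_e(i) in {0, 1}, where R_e(i) is a guess at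
   stage i for a value different from Phi_e^{0'}(e), correct for large i if the
   latter is defined.  Along a Cauchy subsequence each digit converges, so the
   function of the limit digits is not computable in 0'.  But it is if the
   subsequence is computable, since 0' recognises when a digit has stabilised,
   and also if it is 0'-computable and fast. *)

(** * Closure properties of relative computability *)

Lemma fstn_pair m n : fstn (pairn m n) = m.
Proof. by rewrite /fstn /pairn Cantor.cancel_of_to. Qed.

Lemma sndn_pair m n : sndn (pairn m n) = n.
Proof. by rewrite /sndn /pairn Cantor.cancel_of_to. Qed.

Definition pairE := (fstn_pair, sndn_pair).

Lemma pairn_eta n : pairn (fstn n) (sndn n) = n.
Proof.
by rewrite /pairn /fstn /sndn -surjective_pairing Cantor.cancel_to_of.
Qed.

Lemma pairn_inj m n m' n' : pairn m n = pairn m' n' -> m = m' /\ n = n'.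
Proof. by move=> e; rewrite -(fstn_pair m n) -{2}(sndn_pair m n) e !pairE. Qed.

Lemma leq_pairn m n : m + n <= pairn m n.
Proof. by have := Cantor.to_nat_non_decreasing m n; rewrite /pairn; lia. Qed.

Opaque pairn fstn sndn.

Lemma leq_fstn n : fstn n <= n.
Proof.
by rewrite -{2}(pairn_eta n) (leq_trans _ (leq_pairn _ _)) ?leq_addr.
Qed.

Lemma leq_sndn n : sndn n <= n.
Proof.
by rewrite -{2}(pairn_eta n) (leq_trans _ (leq_pairn _ _)) ?leq_addl.
Qed.

Lemma comp_ext A f g : f =1 g -> computable_in A f -> computable_in A g.
Proof. by move=> fg [c Hc]; exists c => x; rewrite -fg. Qed.

Lemma comp_fst A : computable_in A fstn.
Proof. by exists CFst. Qed.

Lemma comp_snd A : computable_in A sndn.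
Proof. by exists CSnd. Qed.

Lemma comp_oracle A : computable_in A A.
Proof. by exists COracle. Qed.

Lemma comp_pairn A f g : computable_in A f -> computable_in A g ->
  computable_in A (fun x => pairn (f x) (g x)).
Proof.
by move=> [c Hc] [d Hd]; exists (CPair c d) => x /=; exists (f x), (g x).
Qed.

Lemma comp_comp A f g : computable_in A f -> computable_in A g ->
  computable_in A (fun x => f (g x)).
Proof. by move=> [c Hc] [d Hd]; exists (CComp c d) => x /=; exists (g x). Qed.

(* Codes are unary: here and below several parameters, and variables bound by
   iteration, search or quantification, are packed into one argument by [pairn]. *)
Lemma comp_comp2 A F f g : computable_in A (fun p => F (fstn p) (sndn p)) ->
  computable_in A f -> computable_in A g ->
  computable_in A (fun x => F (f x) (g x)).
Proof.
move=> cF cf cg; apply: comp_ext (comp_comp cF (comp_pairn cf cg)) => x /=.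
by rewrite !pairE.
Qed.

Lemma comp_comp3 A F f g h :
  computable_in A (fun p => F (fstn p) (fstn (sndn p)) (sndn (sndn p))) ->
  computable_in A f -> computable_in A g -> computable_in A h ->
  computable_in A (fun x => F (f x) (g x) (h x)).
Proof.
move=> cF cf cg ch.
apply: comp_ext (comp_comp cF (comp_pairn cf (comp_pairn cg ch))) => x /=.
by rewrite !pairE.
Qed.

Lemma comp_id A : computable_in A (fun x => x).
Proof. by apply: comp_ext pairn_eta _; apply: comp_pairn; [exists CFst|exists CSnd]. Qed.

Lemma comp_succ A f : computable_in A f -> computable_in A (fun x => (f x).+1).
Proof. by apply: comp_comp; exists CSucc. Qed.

Lemma comp_const A n : computable_in A (fun=> n).
Proof. by elim: n => [|n]; [exists CZero | apply: comp_succ]. Qed.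

(** Primitive recursion with a parameter, obtained from [CPrec] by packing; the arithmetic, the
    bounded quantifiers and [drop] below are reduced to it. *)
Lemma comp_iteri A n G b :
  computable_in A n ->
  computable_in A (fun p => G (fstn p) (fstn (sndn p)) (sndn (sndn p))) ->
  computable_in A b ->
  computable_in A (fun x => iteri (n x) (G x) (b x)).
Proof.
move=> cn [d Hd] [c Hc].
suff : computable_in A (fun p => iteri (sndn p) (G (fstn p)) (b (fstn p))).
  move=> cF; exact: (@comp_comp2 _ (fun x m => iteri m (G x) (b x)) _ _ cF (comp_id A) cn).
exists (CPrec c d) => p /=; elim: (sndn p) => [|m IH] /=; first exact: Hc.
set z := iteri m _ _ in IH *; exists z => //.
by have := Hd (pairn (fstn p) (pairn m z)); rewrite !pairE.
Qed.

Lemma comp_iter A n G b :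
  computable_in A n ->
  computable_in A (fun p => G (fstn p) (sndn p)) ->
  computable_in A b ->
  computable_in A (fun x => iter (n x) (G x) (b x)).
Proof.
move=> cn cG cb.
apply: (@comp_ext _ (fun x => iteri (n x) (fun=> G x) (b x))).
  by move=> x; elim: (n x) => //= m ->.
apply: comp_iteri => //; apply: (comp_comp2 cG); first exact: comp_fst.
exact: (comp_comp (comp_snd _) (comp_snd _)).
Qed.

Lemma comp_pred A f : computable_in A f -> computable_in A (fun x => (f x).-1).
Proof.
(* The iteration forgets its accumulator and returns the last counter, or the start value [0] when
   [f x = 0]. *)
move=> cf; apply: (@comp_ext _ (fun x => iteri (f x) (fun m _ => m) 0)).
  by move=> x; case: (f x).
apply: comp_iteri => //; last exact: comp_const.
exact: (comp_comp (comp_fst _) (comp_snd _)).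
Qed.

Lemma comp_add A f g : computable_in A f -> computable_in A g ->
  computable_in A (fun x => f x + g x).
Proof.
move=> cf cg; apply: (@comp_ext _ (fun x => iter (f x) succn (g x))).
  by move=> x; rewrite iter_succn addnC.
by apply: comp_iter => //; apply: comp_succ; apply: comp_snd.
Qed.

Lemma comp_sub A f g : computable_in A f -> computable_in A g ->
  computable_in A (fun x => f x - g x).
Proof.
move=> cf cg; apply: (@comp_ext _ (fun x => iter (g x) predn (f x))).
  by move=> x; elim: (g x) => /= [|m ->]; rewrite ?subn0 ?subnS.
by apply: comp_iter => //; apply: comp_pred; apply: comp_snd.
Qed.

Lemma comp_mul A f g : computable_in A f -> computable_in A g ->
  computable_in A (fun x => f x * g x).
Proof.
move=> cf cg; apply: (@comp_ext _ (fun x => iter (f x) (addn (g x)) 0)).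
  by move=> x; rewrite iter_addn_0 mulnC.
apply: comp_iter => //; last exact: comp_const.
apply: comp_add; last exact: comp_snd.
exact: (comp_comp cg (comp_fst _)).
Qed.

Lemma comp_exp A f g : computable_in A f -> computable_in A g ->
  computable_in A (fun x => f x ^ g x).
Proof.
move=> cf cg; apply: (@comp_ext _ (fun x => iter (g x) (muln (f x)) 1)).
  by move=> x; rewrite iter_muln_1.
apply: comp_iter => //; last exact: comp_const.
apply: comp_mul; last exact: comp_snd.
exact: (comp_comp cf (comp_fst _)).
Qed.

Notation decidable_in A p := (computable_in A (fun x => nat_of_bool (p x))).

Lemma dec_leq A f g : computable_in A f -> computable_in A g ->
  decidable_in A (fun x => f x <= g x).
Proof.
move=> cf cg; apply: (@comp_ext _ (fun x => 1 - (f x - g x))).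
  by move=> x; rewrite /leq; case: (f x - g x) => [|n]; rewrite ?subSS ?sub0n.
by apply: comp_sub; [exact: comp_const|exact: comp_sub].
Qed.

Lemma dec_not A p : decidable_in A p -> decidable_in A (fun x => ~~ p x).
Proof.
move=> cp; apply: (@comp_ext _ (fun x => 1 - p x)); first by move=> x; case: (p x).
by apply: comp_sub; [exact: comp_const|].
Qed.

Lemma dec_and A p q : decidable_in A p -> decidable_in A q ->
  decidable_in A (fun x => p x && q x).
Proof.
move=> cp cq; apply: (@comp_ext _ (fun x => p x * q x)).
  by move=> x; case: (p x); case: (q x).
exact: comp_mul.
Qed.

Lemma dec_or A p q : decidable_in A p -> decidable_in A q ->
  decidable_in A (fun x => p x || q x).
Proof.
move=> cp cq; apply: (@comp_ext _ (fun x => ~~ (~~ p x && ~~ q x))).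
  by move=> x; rewrite negb_and !negbK.
by apply/dec_not/dec_and; apply: dec_not.
Qed.

Lemma dec_imp A p q : decidable_in A p -> decidable_in A q ->
  decidable_in A (fun x => p x ==> q x).
Proof.
move=> cp cq; apply: (@comp_ext _ (fun x => ~~ p x || q x)).
  by move=> x; rewrite implybE.
by apply: dec_or => //; apply: dec_not.
Qed.

Lemma dec_eqn A f g : computable_in A f -> computable_in A g ->
  decidable_in A (fun x => f x == g x).
Proof.
move=> cf cg; apply: (@comp_ext _ (fun x => (f x <= g x) && (g x <= f x))).
  by move=> x; rewrite eqn_leq.
by apply: dec_and; apply: dec_leq.
Qed.

Lemma dec_eqb A p q : decidable_in A p -> decidable_in A q ->
  decidable_in A (fun x => p x == q x).
Proof.
move=> cp cq; apply: (@comp_ext _ (fun x => (p x : nat) == (q x : nat))).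
  by move=> x; case: (p x); case: (q x).
exact: dec_eqn.
Qed.

Lemma comp_if A p f g : decidable_in A p -> computable_in A f ->
  computable_in A g -> computable_in A (fun x => if p x then f x else g x).
Proof.
move=> cp cf cg; apply: (@comp_ext _ (fun x => p x * f x + (1 - p x) * g x)).
  by move=> x; case: (p x); rewrite ?mul1n ?mul0n ?addn0 ?add0n.
by apply: comp_add; apply: comp_mul => //; apply: comp_sub => //; apply: comp_const.
Qed.

Lemma dec_if A p f g : decidable_in A p -> decidable_in A f ->
  decidable_in A g -> decidable_in A (fun x => if p x then f x else g x).
Proof.
move=> cp cf cg; apply: comp_ext (comp_if cp cf cg).
by move=> x; case: (p x).
Qed.

Lemma comp_odd A f : computable_in A f -> decidable_in A (fun x => odd (f x)).
Proof.
move=> cf; apply: (@comp_ext _ (fun x => iter (f x) (fun z => 1 - z) 0)).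
  by move=> x; elim: (f x) => //= m ->; case: odd.
apply: comp_iter => //; last exact: comp_const.
by apply: comp_sub; [exact: comp_const|exact: comp_snd].
Qed.

Lemma dec_all_iota A n P : computable_in A n ->
  decidable_in A (fun p => P (fstn p) (sndn p)) ->
  decidable_in A (fun x => all (P x) (iota 0 (n x))).
Proof.
move=> cn cP.
apply: (@comp_ext _ (fun x => iteri (n x) (fun m z => z * P x m) 1)).
  move=> x; elim: (n x) => // m IH; rewrite -[in RHS]addn1 iotaD all_cat add0n.
  by rewrite /= IH andbT; case: (all _ _); case: (P x m).
apply: comp_iteri => //; last exact: comp_const.
apply: comp_mul; first exact: (comp_comp (comp_snd _) (comp_snd _)).
apply: (@comp_comp2 _ (fun x y => nat_of_bool (P x y)) _ _ cP); first exact: comp_fst.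
exact: (comp_comp (comp_fst _) (comp_snd _)).
Qed.

Lemma dec_has_iota A n P : computable_in A n ->
  decidable_in A (fun p => P (fstn p) (sndn p)) ->
  decidable_in A (fun x => has (P x) (iota 0 (n x))).
Proof.
move=> cn cP.
apply: (@comp_ext _ (fun x => ~~ all (fun m => ~~ P x m) (iota 0 (n x)))).
  by move=> x; rewrite -has_predC; congr nat_of_bool; apply: eq_has => m; rewrite /= negbK.
by apply/dec_not/dec_all_iota => //; apply: dec_not.
Qed.

(** [CMu] searches for a value 0, hence the passage to the negation of [P], whose values before the
    first zero are 1. *)
Lemma comp_mu A (P : nat -> nat -> bool) f :
  decidable_in A (fun p => P (fstn p) (sndn p)) ->
  (forall x, P x (f x)) -> (forall x m, m < f x -> ~~ P x m) ->
  computable_in A f.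
Proof.
move=> /dec_not[c Hc] Pf Pmin; exists (CMu c) => x /=; split.
  by have := Hc (pairn x (f x)); rewrite !pairE Pf.
by move=> m /Pmin nP; exists 0; have := Hc (pairn x m); rewrite !pairE nP.
Qed.

(** Least witnesses are found by search, so choices made in this way stay computable. *)
Lemma comp_ex_minn A (P : nat -> nat -> bool) (exP : forall x, exists m, P x m) :
  decidable_in A (fun p => P (fstn p) (sndn p)) ->
  computable_in A (fun x => ex_minn (exP x)).
Proof.
move=> cP; apply: (comp_mu cP) => x; case: ex_minnP => // m Pm minm.
by move=> k; rewrite ltnNge; apply: contraNN => /minm.
Qed.

(** * Codes of finite lists of numbers *)

Fixpoint lcode (l : seq nat) : nat :=
  if l is a :: l' then (pairn a (lcode l')).+1 else 0.

(** [k] is fuel; [n] itself is enough, since [sndn m <= m] makes the code decrease at each step. *)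
Fixpoint ldec_rec (k n : nat) : seq nat :=
  match k, n with
  | k'.+1, m.+1 => fstn m :: ldec_rec k' (sndn m)
  | _, _ => [::]
  end.

Definition ldec (n : nat) : seq nat := ldec_rec n n.

Lemma lcode_inj : injective lcode.
Proof.
elim=> [|a l IH] [|b m] //= [] /pairn_inj[-> /IH ->] //.
Qed.

Lemma ldecK : cancel ldec lcode.
Proof.
suff H k n : n <= k -> lcode (ldec_rec k n) = n by move=> n; apply: H.
elim: k n => [|k IH] [|n] //= nk; rewrite IH ?pairn_eta //.
by have := leq_sndn n; lia.
Qed.

Lemma lcodeK : cancel lcode ldec.
Proof. by move=> l; apply: lcode_inj; rewrite ldecK. Qed.

(** Later this shows that a derivation with a small code cannot mention a large program number. *)
Lemma ltn_mem_lcode t l : t \in l -> t < lcode l.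
Proof.
elim: l => //= a l IH; have := leq_pairn a (lcode l).
by rewrite inE => le /orP[/eqP ->|/IH]; lia.
Qed.

Notation list_computable_in A l := (computable_in A (fun x => lcode (l x))).

Lemma comp_ldec A f : computable_in A f -> list_computable_in A (fun x => ldec (f x)).
Proof. by apply: comp_ext => x; rewrite ldecK. Qed.

Lemma comp_cons A a l : computable_in A a -> list_computable_in A l ->
  list_computable_in A (fun x => a x :: l x).
Proof. by move=> ca cl; apply: comp_succ; apply: comp_pairn. Qed.

Lemma fstn0 : fstn 0 = 0. Proof. by have := leq_fstn 0; case: fstn. Qed.

Lemma sndn0 : sndn 0 = 0. Proof. by have := leq_sndn 0; case: sndn. Qed.

Lemma comp_head A l : list_computable_in A l ->
  computable_in A (fun x => head 0 (l x)).
Proof.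
move=> cl; apply: (@comp_ext _ (fun x => fstn (lcode (l x)).-1)).
  by move=> x; case: (l x) => /= [|a m]; rewrite ?fstn0 ?pairE.
by apply: comp_comp (comp_fst _) _; apply: comp_pred.
Qed.

Lemma comp_drop A n l : computable_in A n -> list_computable_in A l ->
  list_computable_in A (fun x => drop (n x) (l x)).
Proof.
move=> cn cl.
(* On codes, removing the head is [sndn z.-1], which fixes [0], the code of the empty list. *)
apply: (@comp_ext _ (fun x => iter (n x) (fun z => sndn z.-1) (lcode (l x)))).
  move=> x; elim: (n x) (l x) => [|m IH] s; rewrite ?drop0 //.
  rewrite iterSr; case: s => [|a s] /=; last by rewrite sndn_pair -IH.
  by have := IH [::]; rewrite sndn0.
apply: comp_iter => //; apply: comp_comp (comp_snd _) _.
by apply: comp_pred; apply: comp_snd.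
Qed.

Lemma comp_nth A n l : computable_in A n -> list_computable_in A l ->
  computable_in A (fun x => nth 0 (l x) (n x)).
Proof.
move=> cn cl; apply: comp_ext (comp_head (comp_drop cn cl)) => x.
by rewrite -nth0 nth_drop addn0.
Qed.

(** The size is the least [m] such that dropping [m] elements leaves the empty list. *)
Lemma comp_size A l : list_computable_in A l ->
  computable_in A (fun x => size (l x)).
Proof.
move=> cl; apply: (@comp_mu _ (fun x m => lcode (drop m (l x)) <= 0)).
- apply: dec_leq (comp_const _ _).
  apply: (@comp_drop _ sndn (fun p => l (fstn p))); first exact: comp_snd.
  exact: (comp_comp cl (comp_fst _)).
- by move=> x; rewrite drop_size.
- by move=> x m lt_m; case: drop (size_drop m (l x)) => //=; lia.
Qed.

Lemma dec_all A P l :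
  list_computable_in A l -> decidable_in A (fun p => P (fstn p) (sndn p)) ->
  decidable_in A (fun x => all (P x) (l x)).
Proof.
move=> cl cP.
apply: (@comp_ext _ (fun x => all (fun j => P x (nth 0 (l x) j)) (iota 0 (size (l x))))).
  by move=> x; rewrite -[in RHS](mkseq_nth 0 (l x)) all_map.
apply: (@dec_all_iota _ _ (fun x j => P x (nth 0 (l x) j))); first exact: comp_size.
apply: (@comp_comp2 _ (fun x y => nat_of_bool (P x y)) _ _ cP); first exact: comp_fst.
apply: (@comp_nth _ sndn (fun p => l (fstn p))); first exact: comp_snd.
exact: (comp_comp cl (comp_fst _)).
Qed.

Lemma dec_has A P l :
  list_computable_in A l -> decidable_in A (fun p => P (fstn p) (sndn p)) ->
  decidable_in A (fun x => has (P x) (l x)).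
Proof.
move=> cl cP.
apply: (@comp_ext _ (fun x => ~~ all (fun m => ~~ P x m) (l x))).
  by move=> x; rewrite -has_predC; congr nat_of_bool; apply: eq_has => m; rewrite /= negbK.
by apply/dec_not/dec_all => //; apply: dec_not.
Qed.

Lemma dec_mem A f l : computable_in A f -> list_computable_in A l ->
  decidable_in A (fun x => f x \in l x).
Proof.
move=> cf cl; apply: (@comp_ext _ (fun x => has (fun m => m == f x) (l x))).
  by move=> x; rewrite has_pred1.
apply: (@dec_has _ (fun x m => m == f x)) => //; apply: dec_eqn; first exact: comp_snd.
exact: (comp_comp cf (comp_fst _)).
Qed.

Lemma dec_eql A l m : list_computable_in A l -> list_computable_in A m ->
  decidable_in A (fun x => l x == m x).
Proof.
move=> cl cm; apply: (comp_ext _ (dec_eqn cl cm)) => x.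
by rewrite (inj_eq lcode_inj).
Qed.

(** One step of a syntax-directed proof of computability: the outermost operation is peeled off,
    hypotheses on functions of packed arguments are composed, and a bare function is
    eta-expanded. *)
Ltac comp_step :=
  match goal with
  | H : computable_in ?A ?f |- computable_in ?A ?g => exact: H
  | |- computable_in _ fstn => exact: comp_fst
  | |- computable_in _ sndn => exact: comp_snd
  | |- computable_in _ (fun x => x) => exact: comp_id
  | |- computable_in _ (fun _ => ?c) => exact: comp_const
  | |- computable_in _ (fun x => fstn (@?f x)) =>
      apply: (comp_comp (comp_fst _) (g := f))
  | |- computable_in _ (fun x => sndn (@?f x)) =>
      apply: (comp_comp (comp_snd _) (g := f))
  | |- computable_in _ (fun x => pairn (@?f x) (@?g x)) =>
      apply: (comp_pairn (f := f) (g := g))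
  | |- computable_in _ (fun x => S (@?f x)) => apply: (comp_succ (f := f))
  | |- computable_in _ (fun x => predn (@?f x)) => apply: (comp_pred (f := f))
  | |- computable_in _ (fun x => addn (@?f x) (@?g x)) =>
      apply: (comp_add (f := f) (g := g))
  | |- computable_in _ (fun x => subn (@?f x) (@?g x)) =>
      apply: (comp_sub (f := f) (g := g))
  | |- computable_in _ (fun x => muln (@?f x) (@?g x)) =>
      apply: (comp_mul (f := f) (g := g))
  | |- computable_in _ (fun x => expn (@?f x) (@?g x)) =>
      apply: (comp_exp (f := f) (g := g))
  | |- computable_in _ (fun x => nat_of_bool (negb (@?p x))) =>
      apply: (dec_not (p := p))
  | |- computable_in _ (fun x => nat_of_bool (andb (@?p x) (@?q x))) =>
      apply: (dec_and (p := p) (q := q))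
  | |- computable_in _ (fun x => nat_of_bool (orb (@?p x) (@?q x))) =>
      apply: (dec_or (p := p) (q := q))
  | |- computable_in _ (fun x => nat_of_bool (implb (@?p x) (@?q x))) =>
      apply: (dec_imp (p := p) (q := q))
  | |- computable_in _ (fun x => nat_of_bool (leq (@?p x) (@?q x))) =>
      apply: (dec_leq (f := p) (g := q))
  | |- computable_in _ (fun x => nat_of_bool (odd (@?p x))) =>
      apply: (comp_odd (f := p))
  | |- computable_in _ (fun x => nat_of_bool (all (@?P x) (iota 0 (@?n x)))) =>
      apply: (dec_all_iota (n := n) (P := P))
  | |- computable_in _ (fun x => nat_of_bool (has (@?P x) (iota 0 (@?n x)))) =>
      apply: (dec_has_iota (n := n) (P := P))
  | |- computable_in _ (fun x => nat_of_bool (all (@?P x) (@?l x))) =>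
      apply: (dec_all (l := l) (P := P))
  | |- computable_in _ (fun x => nat_of_bool (has (@?P x) (@?l x))) =>
      apply: (dec_has (l := l) (P := P))
  | |- computable_in _ (fun x => nat_of_bool (eq_op (@?p x) (@?q x))) =>
      first [apply: (dec_eqn (f := p) (g := q)) | apply: (dec_eqb (p := p) (q := q))
            | apply: (dec_eql (l := p) (m := q))]
  | |- computable_in _ (fun x => nat_of_bool (in_mem (@?f x) (mem (@?l x)))) =>
      apply: (dec_mem (f := f) (l := l))
  | |- computable_in _ (fun x => if _ then _ else _) => apply: comp_if
  | |- computable_in _ (fun x => nat_of_bool (if _ then _ else _)) => apply: dec_if
  | |- computable_in _ (fun x => lcode (ldec (@?f x))) => apply: (comp_ldec (f := f))
  | |- computable_in _ (fun x => lcode (cons (@?f x) (@?l x))) =>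
      apply: (comp_cons (a := f) (l := l))
  | |- computable_in _ (fun x => lcode (drop (@?f x) (@?l x))) =>
      apply: (comp_drop (n := f) (l := l))
  | |- computable_in _ (fun x => nth 0 (@?l x) (@?f x)) =>
      apply: (comp_nth (n := f) (l := l))
  | |- computable_in _ (fun x => head 0 (@?l x)) => apply: (comp_head (l := l))
  | |- computable_in _ (fun x => size (@?l x)) => apply: (comp_size (l := l))
  | |- computable_in _ (fun x => iter (@?n x) (@?G x) (@?b x)) =>
      apply: (comp_iter (n := n) (G := G) (b := b))
  | |- computable_in _ (fun x => iteri (@?n x) (@?G x) (@?b x)) =>
      apply: (comp_iteri (n := n) (G := G) (b := b))
  | H : computable_in ?A (fun p => nat_of_bool (?F (fstn p) (fstn (sndn p)) (sndn (sndn p))))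
    |- computable_in ?A (fun x => nat_of_bool (?F (@?f x) (@?g x) (@?h x))) =>
      let G := constr:(fun x y z => nat_of_bool (F x y z)) in
      apply: (@comp_comp3 A G f g h H)
  | H : computable_in ?A (fun p => ?F (fstn p) (fstn (sndn p)) (sndn (sndn p)))
    |- computable_in ?A (fun x => ?F (@?f x) (@?g x) (@?h x)) =>
      apply: (comp_comp3 (F := F) (f := f) (g := g) (h := h) H)
  | H : computable_in ?A (fun p => nat_of_bool (?F (fstn p) (sndn p)))
    |- computable_in ?A (fun x => nat_of_bool (?F (@?f x) (@?g x))) =>
      let G := constr:(fun x y => nat_of_bool (F x y)) in
      apply: (@comp_comp2 A G f g H)
  | H : computable_in ?A (fun p => ?F (fstn p) (sndn p))
    |- computable_in ?A (fun x => ?F (@?f x) (@?g x)) =>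
      apply: (comp_comp2 (F := F) (f := f) (g := g) H)
  | H : computable_in ?A (fun x => lcode (?F x))
    |- computable_in ?A (fun x => lcode (?F (@?f x))) =>
      let G := constr:(fun x => lcode (F x)) in apply: (@comp_comp A G f H)
  | H : computable_in ?A (fun x => nat_of_bool (?F x))
    |- computable_in ?A (fun x => nat_of_bool (?F (@?f x))) =>
      let G := constr:(fun x => nat_of_bool (F x)) in apply: (@comp_comp A G f H)
  | H : computable_in ?A ?F |- computable_in ?A (fun x => ?F (@?f x)) =>
      apply: (comp_comp (f := F) (g := f) H)
  | |- computable_in ?A ?f =>
      lazymatch f with
      | (fun _ => _) => fail
      | _ => change (computable_in A (fun x => f x))
      end
  end.

Ltac comp := cbv beta in *; repeat (comp_step; cbv beta).

(** * Derivations and the normal form of the jump *)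

Lemma encode_inj : injective encode.
Proof.
elim=> [|||||c IHc d IHd|c IHc d IHd|c IHc d IHd|c IHc] [|||||c' d'|c' d'|c' d'|c'] //=
  /pairn_inj[] //.
all: try by move=> _ /pairn_inj[/IHc -> /IHd ->].
by move=> _ /IHc ->.
Qed.

Lemma prim_rec_mono (F F' G G' : nat -> nat -> Prop) a n y :
  (forall x z, F x z -> F' x z) -> (forall x z, G x z -> G' x z) ->
  prim_rec F G a n y -> prim_rec F' G' a n y.
Proof.
move=> FF GG; elim: n y => [|n IH] y /=; first exact: FF.
by move=> [z /IH Hz /GG HG]; exists z.
Qed.

(** Each oracle call is replaced by a program for [A]. It suffices to carry over halting
    computations, a claim that passes through every constructor by monotonicity. *)
Lemma comp_trans A B f : computable_in B A -> computable_in A f -> computable_in B f.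
Proof.
move=> [d Hd] [c Hc].
suff [c' Hc'] : exists c', forall x y, code_eval A c x y -> code_eval B c' x y.
  by exists c' => x; apply: Hc'.
elim: c {f Hc} => [|||||c [c' IHc] e [e' IHe]|c [c' IHc] e [e' IHe]
  |c [c' IHc] e [e' IHe]|c [c' IHc]].
- by exists CZero.
- by exists CSucc.
- by exists CFst.
- by exists CSnd.
- by exists d => x y /= ->.
- exists (CPair c' e') => x y /= [u [v [/IHc Hu /IHe Hv ->]]].
  by exists u, v.
- by exists (CComp c' e') => x y /= [z /IHe Hz /IHc Hy]; exists z.
- by exists (CPrec c' e') => x y /=; apply: prim_rec_mono.
- exists (CMu c') => x y /= [/IHc H0 H]; split=> // m /H[v /IHc Hv].
  by exists v.
Qed.

Lemma code_eval_det A c x y z : code_eval A c x y -> code_eval A c x z -> y = z.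
Proof.
elim: c x y z => /= [|||||c IHc d IHd|c IHc d IHd|c IHc d IHd|c IHc] x y z;
  try by move=> -> ->.
- by move=> [u [v [/IHc Hu /IHd Hv ->]]] [u' [v' [/Hu -> /Hv -> ->]]].
- by move=> [u /IHd Hu /IHc Hy] [v /Hu <- /Hy].
- elim: (sndn x) y z => [|n IHn] y z /=; first exact: IHc.
  by move=> [u /IHn Hu /IHd Hy] [v /Hu <- /Hy].
(* If the two minima differed, the tested value at the smaller one would be both zero and a
   successor. *)
- move=> [Hy Ly] [Hz Lz]; case: (ltngtP y z) => //.
    by move=> /Lz[v /(IHc _ _ _ Hy)].
  by move=> /Ly[v /(IHc _ _ _ Hz)].
Qed.

(* The entry with [w = 0] claims that [e] numbers a program, the one with
   [w = y.+1] that program [e] maps [x] to [y].  A derivation is a list of entries,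
   each [justified] by the entries after it. *)
Definition entry (e x w : nat) : nat := pairn e (pairn x w).

Lemma entry_code e x w : fstn (entry e x w) = e.
Proof. exact: fstn_pair. Qed.

Lemma entry_arg e x w : fstn (sndn (entry e x w)) = x.
Proof. by rewrite /entry !pairE. Qed.

Lemma entry_val e x w : sndn (sndn (entry e x w)) = w.
Proof. by rewrite /entry !pairE. Qed.

(** A number [e] splits into a constructor tag [k] and its arguments [a]. Intermediate values are
    read off entries of [L], so every search is bounded; the form [.-1.+1] demands an actual output,
    and [.-2.+2] a nonzero one. *)
Definition justified (o : nat -> nat) (L : seq nat) (t : nat) : bool :=
  let e := fstn t in let x := fstn (sndn t) in let w := sndn (sndn t) in
  let k := fstn e in let a := sndn e in let y := w.-1 in
  let e1 := fstn a in let e2 := sndn a in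
  if w == 0 then
    if k <= 4 then a == 0
    else if k <= 7 then (entry e1 0 0 \in L) && (entry e2 0 0 \in L)
    else (k == 8) && (entry a 0 0 \in L)
  else if k == 0 then y == 0
  else if k == 1 then y == x.+1
  else if k == 2 then y == fstn x
  else if k == 3 then y == sndn x
  else if k == 4 then y == o x
  else if k == 5 then
    (entry e1 x (fstn y).+1 \in L) && (entry e2 x (sndn y).+1 \in L)
  else if k == 6 then
    has (fun u => (u == entry e2 x (sndn (sndn u)).-1.+1) &&
                  (entry e1 (sndn (sndn u)).-1 w \in L)) L
  else if k == 7 then
    if sndn x == 0 then entry e1 (fstn x) w \in L
    else has (fun u =>
      (u == entry e (pairn (fstn x) (sndn x).-1) (sndn (sndn u)).-1.+1) &&
      (entry e2 (pairn (fstn x) (pairn (sndn x).-1 (sndn (sndn u)).-1)) w \in L)) L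
  else [&& k == 8, entry a (pairn x y) 1 \in L &
    all (fun m => has (fun u => u == entry a (pairn x m) (sndn (sndn u)).-2.+2) L)
        (iota 0 y)].

Arguments justified : simpl never.

Lemma dec_justified A o L t :
  computable_in A (fun p => o (fstn p) (sndn p)) ->
  list_computable_in A L -> computable_in A t ->
  decidable_in A (fun x => justified (o x) (L x) (t x)).
Proof.
move=> co cL ct; by rewrite /justified /entry; cbv zeta; comp.
Qed.

Lemma has_sub (P Q : pred nat) (L L' : seq nat) :
  {subset L <= L'} -> subpred P Q -> has P L -> has Q L'.
Proof. by move=> sub PQ /hasP[u uL /PQ Qu]; apply/hasP; exists u; rewrite ?sub. Qed.

(** Membership in [L] occurs only positively. *)
Lemma justified_sub o L L' t :
  {subset L <= L'} -> justified o L t -> justified o L' t.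
Proof.
move=> sub; rewrite /justified; cbv zeta.
do !case: ifP => _; try match goal with |- ?P -> ?P => exact: id end.
- by case/andP => /sub -> /sub ->.
- by case/andP => -> /sub ->.
- by case/andP => /sub -> /sub ->.
- by apply: has_sub => // u /andP[-> /sub ->].
- exact: sub.
- by apply: has_sub => // u /andP[-> /sub ->].
- case/and3P => -> /sub -> /allP H /=; apply/allP => m /H.
  exact: has_sub.
Qed.

(** The oracle is consulted only at the argument stored in [t], which is at most [t]. *)
Lemma justified_agree o o' L t :
  (forall x, x < t.+1 -> o x = o' x) -> justified o L t = justified o' L t.
Proof.
move=> oo; rewrite /justified; cbv zeta; rewrite oo //.
by have := leq_fstn (sndn t); have := leq_sndn t; lia.
Qed.

Definition valid (o : nat -> nat) (L : seq nat) : bool :=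
  all (fun j => justified o (drop j.+1 L) (nth 0 L j)) (iota 0 (size L)).

Arguments valid : simpl never.

Lemma all_iotaS (P : pred nat) n :
  all P (iota 0 n.+1) = P 0 && all (fun j => P j.+1) (iota 0 n).
Proof. by rewrite /= -[1]addn0 iotaDl all_map. Qed.

Lemma all_suffix_cons (J : seq nat -> nat -> bool) t L :
  all (fun j => J (drop j.+1 (t :: L)) (nth 0 (t :: L) j)) (iota 0 (size (t :: L)))
  = J L t && all (fun j => J (drop j.+1 L) (nth 0 L j)) (iota 0 (size L)).
Proof. by rewrite all_iotaS drop1. Qed.

Lemma valid_cons o t L : valid o (t :: L) = justified o L t && valid o L.
Proof. exact: (all_suffix_cons (justified o)). Qed.

Lemma dec_valid A o L :
  computable_in A (fun p => o (fstn p) (sndn p)) -> list_computable_in A L ->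
  decidable_in A (fun x => valid (o x) (L x)).
Proof.
move=> co cL.
have cj := @dec_justified A (fun p => o (fstn p)) (fun p => drop (sndn p).+1 (L (fstn p)))
  (fun p => nth 0 (L (fstn p)) (sndn p)).
apply: (@dec_all_iota _ _ (fun x j => justified (o x) (drop j.+1 (L x)) (nth 0 (L x) j))).
  by comp.
by apply: cj; comp.
Qed.

(** The use principle: every oracle query of a derivation lies below its code, since the code
    exceeds all entries. *)
Lemma valid_agree o o' L :
  (forall x, x < lcode L -> o x = o' x) -> valid o L = valid o' L.
Proof.
elim: L => [|t L IH] oo; first by rewrite /valid.
have := leq_pairn t (lcode L) => le.
rewrite !valid_cons IH; last by move=> x xL; apply: oo => /=; lia.
by congr andb; apply: justified_agree => x xt; apply: oo => /=; lia.
Qed.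

(** Entries of [L] keep their premises and only gain entries behind them; those of [L'] see the same
    tail as before. *)
Lemma valid_cat o L L' : valid o L -> valid o L' -> valid o (L ++ L').
Proof.
elim: L => // t L IH; rewrite cat_cons !valid_cons => /andP[jt vL] vL'.
rewrite IH // andbT; apply: justified_sub jt => u.
by rewrite mem_cat => ->.
Qed.

Definition derivable (o : nat -> nat) (t : nat) : Prop :=
  exists2 L, valid o L & t \in L.

Lemma derivable_all o (ts : seq nat) : (forall t, t \in ts -> derivable o t) ->
  exists2 L, valid o L & {subset ts <= L}.
Proof.
elim: ts => [|t ts IH] H; first by exists [::].
have [|L vL sL] := IH; first by move=> u uts; apply: H; rewrite inE uts orbT.
have [|L' vL' tL'] := H t; first by rewrite mem_head.
exists (L' ++ L) => [|u]; first exact: valid_cat.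
by rewrite mem_cat inE => /orP[/eqP ->|/sL ->]; rewrite ?tL' ?orbT.
Qed.

(** Premises may have separate derivations, as these can be concatenated; derivability thus behaves
    like an inductive predicate. *)
Lemma derivable_intro o (ts : seq nat) t :
  (forall u, u \in ts -> derivable o u) -> justified o ts t -> derivable o t.
Proof.
move=> /derivable_all[L vL sL] jt; exists (t :: L); last exact: mem_head.
by rewrite valid_cons vL andbT; apply: justified_sub jt.
Qed.

Lemma derivable1 o t : justified o [::] t -> derivable o t.
Proof. by apply: derivable_intro. Qed.

Lemma derivable2 o u v t : derivable o u -> derivable o v ->
  justified o [:: u; v] t -> derivable o t.
Proof. by move=> du dv; apply: derivable_intro => w; rewrite !inE => /orP[]/eqP->. Qed.

Definition entryE :=
  (entry_code, entry_arg, entry_val, fstn_pair, sndn_pair, eqxx, inE, orbT, andbT).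

Lemma derivable_code o c : derivable o (entry (encode c) 0 0).
Proof.
elim: c => [|||||c IHc d IHd|c IHc d IHd|c IHc d IHd|c IHc] /=;
  try by apply: derivable1; rewrite /justified; cbv zeta; rewrite !entryE.
- by apply: (derivable2 IHc IHd); rewrite /justified; cbv zeta; rewrite !entryE.
- by apply: (derivable2 IHc IHd); rewrite /justified; cbv zeta; rewrite !entryE.
- by apply: (derivable2 IHc IHd); rewrite /justified; cbv zeta; rewrite !entryE.
- by apply: (derivable2 IHc IHc); rewrite /justified; cbv zeta; rewrite !entryE.
Qed.

Lemma derivable_eval o c x y :
  code_eval o c x y -> derivable o (entry (encode c) x y.+1).
Proof.
elim: c x y => [|||||c IHc d IHd|c IHc d IHd|c IHc d IHd|c IHc] x y /=.
1-5: by move=> ->; apply: derivable1; rewrite /justified; cbv zeta; rewrite !entryE /= ?entryE.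
- move=> [u [v [/IHc Hu /IHd Hv ->]]]; apply: (derivable2 Hu Hv).
  by rewrite /justified; cbv zeta; rewrite !entryE /= ?entryE.
- move=> [u /IHd Hu /IHc Hy]; apply: (derivable2 Hu Hy).
  by rewrite /justified; cbv zeta; rewrite !entryE /= ?entryE.
(* Exposes the counter inside the entry, so that the induction on it acts on both sides. *)
- rewrite -{3}(pairn_eta x).
  elim: (sndn x) y => [|n IHn] y /=.
    move=> /IHc H; apply: (derivable2 H H).
    by rewrite /justified; cbv zeta; rewrite !entryE /= ?entryE.
  move=> [z /IHn Hz /IHd Hy]; apply: (derivable2 Hz Hy).
  by rewrite /justified; cbv zeta; rewrite !entryE /= ?entryE.
- move=> [/IHc H0 Hlt].
  (* The positive values before the zero, chosen all at once; from [y] on, 0 is a dummy. *)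
  have /choice[v Hv] m : exists v, m < y -> code_eval o c (pairn x m) v.+1.
    case: (ltnP m y) => [/Hlt[v Hv]|_]; last by exists 0.
    by exists v.
  apply: (@derivable_intro _ (entry (encode c) (pairn x y) 1 ::
      [seq entry (encode c) (pairn x m) (v m).+2 | m <- iota 0 y])).
    move=> u; rewrite inE => /orP[/eqP ->//|/mapP[m]].
    by rewrite mem_iota /= => my ->; apply/IHc/Hv.
  rewrite /justified; cbv zeta; rewrite !entryE /= ?entryE /=.
  apply/allP => m my; apply/orP; right; apply/hasP.
  exists (entry (encode c) (pairn x m) (v m).+2); last by rewrite !entryE.
  by apply/mapP; exists m.
Qed.

(** Both claims go by induction on the list, as the premises of an entry lie in its tail. *)
Lemma derivable_sound o t : derivable o t ->
  (sndn (sndn t) = 0 -> exists c, encode c = fstn t) /\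
  (forall c y, sndn (sndn t) = y.+1 -> encode c = fstn t ->
     code_eval o c (fstn (sndn t)) y).
Proof.
move=> [L]; elim: L t => // t L IH u; rewrite valid_cons => /andP[jt vL].
rewrite inE => /orP[/eqP -> {u}|]; last exact: IH.
have {vL}IH u : u \in L -> _ := IH u vL.
have codeL e : entry e 0 0 \in L -> exists c, encode c = e.
  by move=> /IH[]; rewrite !entryE => /(_ erefl).
have evalL e c x y : entry e x y.+1 \in L -> encode c = e -> code_eval o c x y.
  by move=> /IH[_ H] ce; have := H c y; rewrite !entryE; apply.
move: jt; rewrite /justified; cbv zeta; case: ifP => [/eqP w0|/negbT wn0].
  rewrite w0; move=> H; split=> // _; move: H; rewrite -(pairn_eta (fstn t)) !pairE.
  case: (fstn (fstn t)) => [|[|[|[|[|[|[|[|[|k]]]]]]]]] //=.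
  - by move/eqP ->; exists CZero.
  - by move/eqP ->; exists CSucc.
  - by move/eqP ->; exists CFst.
  - by move/eqP ->; exists CSnd.
  - by move/eqP ->; exists COracle.
  - move=> /andP[/codeL[c ce] /codeL[d de]]; exists (CPair c d).
    by rewrite /= ce de pairn_eta.
  - move=> /andP[/codeL[c ce] /codeL[d de]]; exists (CComp c d).
    by rewrite /= ce de pairn_eta.
  - move=> /andP[/codeL[c ce] /codeL[d de]]; exists (CPrec c d).
    by rewrite /= ce de pairn_eta.
  - by move=> /codeL[c ce]; exists (CMu c); rewrite /= ce.
move=> H; split=> [w0|c y wy]; first by rewrite w0 in wn0.
move: H; rewrite wy /= => H ce; move: H; rewrite -ce.
have {}evalL c' x' y' : entry (encode c') x' y'.+1 \in L -> code_eval o c' x' y'.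
  by move=> /evalL; apply.
case: c ce => [|||||c d|c d|c d|c] ce /=; rewrite ?pairE /=; try by move/eqP.
- move=> /andP[/evalL Hu /evalL Hv]; exists (fstn y), (sndn y).
  by rewrite pairn_eta.
- move=> /hasP[u uL /andP[/eqP uE /evalL Hy]]; exists (sndn (sndn u)).-1 => //.
  by apply: evalL; rewrite -uE.
- case: ifP => [/eqP -> /evalL //|/negbT]; case: (sndn (fstn (sndn t))) => // n _ /=.
  move=> /hasP[u uL /andP[/eqP uE /evalL Hy]]; exists (sndn (sndn u)).-1 => //.
  (* The premise at the smaller counter names the recursion itself, so the hypothesis is applied to
     [CPrec c d] and not to a subprogram. *)
  have := @evalL (CPrec c d) (pairn (fstn (fstn (sndn t))) n) (sndn (sndn u)).-1.
  by rewrite /= -uE !pairE; apply.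
- move=> /andP[/evalL H0 /allP H]; split=> // m my.
  have /hasP[u uL /eqP uE] : has (fun u : nat =>
      u == entry (encode c) (pairn (fstn (sndn t)) m) (sndn (sndn u)).-2.+2) L.
    by apply: H; rewrite mem_iota.
  by exists (sndn (sndn u)).-2; apply: evalL; rewrite -uE.
Qed.

(** Kleene's predicate on the diagonal, with a derivation as the computation. [entry e 0 0] is
    demanded because justifying an output does not check that [e] numbers a program; for instance,
    tag 0 then ignores the argument part. *)
Definition halts (o : nat -> nat) (e : nat) (L : seq nat) : bool :=
  [&& valid o L, entry e 0 0 \in L &
      has (fun u => (u == entry e e (sndn (sndn u))) && (0 < sndn (sndn u))) L].

Arguments halts : simpl never.

Lemma dec_halts A o e L :
  computable_in A (fun p => o (fstn p) (sndn p)) -> computable_in A e ->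
  list_computable_in A L ->
  decidable_in A (fun x => halts (o x) (e x) (L x)).
Proof.
move=> co ce cL; rewrite /halts /entry; apply: dec_and; first exact: dec_valid.
by comp.
Qed.

Lemma halts_agree o o' e L :
  (forall x, x < lcode L -> o x = o' x) -> halts o e L = halts o' e L.
Proof. by move=> oo; rewrite /halts (valid_agree oo). Qed.

(** The normal form theorem: derivations are complete and sound for evaluation, so halting is the
    existence of a decidable certificate. *)
Lemma jumpE A e : jump A e = `[< exists L, halts A e L >].
Proof.
rewrite /jump; congr (nat_of_bool _); apply/asbool_equiv_eq; split.
  move=> [c ce [y /derivable_eval Hy]]; have Hc := derivable_code A c.
  rewrite ce in Hy Hc.
  have [|L vL sL] := @derivable_all A [:: entry e 0 0; entry e e y.+1].
    by move=> t; rewrite !inE => /orP[]/eqP ->.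
  exists L; rewrite /halts vL sL ?mem_head //=; apply/hasP.
  exists (entry e e y.+1); first by apply: sL; rewrite !inE eqxx orbT.
  by rewrite !entryE.
move=> [L /and3P[vL cL /hasP[u uL /andP[/eqP uE u0]]]].
have [c ce] : exists c, encode c = e.
  have [] // := @derivable_sound A (entry e 0 0); first by exists L.
  by rewrite !entryE => /(_ erefl).
exists c => //; exists (sndn (sndn u)).-1.
have [|_] := @derivable_sound A u; first by exists L.
move=> /(_ c (sndn (sndn u)).-1); rewrite prednK // uE !entryE.
by apply.
Qed.

(** * Existential questions and the jump *)

Fixpoint const_code (n : nat) : Defs.code :=
  if n is m.+1 then CComp CSucc (const_code m) else CZero.

Lemma const_codeP A n x y : code_eval A (const_code n) x y <-> y = n.
Proof.
elim: n y => [|n IH] y //=; split=> [[z /IH -> //]|->].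
by exists n => //; apply/IH.
Qed.

Lemma comp_const_code A : computable_in A (fun n => encode (const_code n)).
Proof.
(* 6 is the tag of [CComp], while [pairn 1 0] and [pairn 0 0] number [CSucc] and [CZero]. *)
apply: (@comp_ext _ (fun n => iter n (fun z => pairn 6 (pairn (pairn 1 0) z)) (pairn 0 0))).
  by elim=> //= n ->.
by comp.
Qed.

(* The search program for [P x _] is made into a program that ignores its own
   input, so that its halting problem is the question [exists y, P x y]. *)
Lemma sigma1_jump A (P : nat -> nat -> bool) :
  decidable_in A (fun p => P (fstn p) (sndn p)) ->
  decidable_in (jump A) (fun x => `[< exists y, P x y >]).
Proof.
move=> cP; have [c Hc] := dec_not cP.
pose e x := encode (CComp (CMu c) (const_code x)).
have ce : computable_in (jump A) e.
  have cc := comp_const_code (jump A).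
  by rewrite /e /=; comp.
apply: comp_ext (comp_comp (comp_oracle (jump A)) ce) => x.
rewrite /jump; congr (nat_of_bool _); apply/asbool_equiv_eq; split.
  move=> [c' /encode_inj -> [y [z /const_codeP ->]]] [+ _].
  have := Hc (pairn x y); rewrite !pairE => H1 /(code_eval_det H1) /eqP.
  by rewrite eqb0 negbK; exists y.
move=> exP; exists (CComp (CMu c) (const_code x)) => //.
exists (ex_minn exP); exists x; first exact/const_codeP.
case: ex_minnP => m Pm minm; split.
  by have := Hc (pairn x m); rewrite !pairE Pm.
move=> k km; exists 0; have := Hc (pairn x k); rewrite !pairE.
by case Pk: (P x k) => //; have := minm _ Pk; rewrite leqNgt km.
Qed.

Lemma sigma1_compl_jump A (P : nat -> nat -> bool) :
  decidable_in A (fun p => P (fstn p) (sndn p)) ->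
  decidable_in (jump A) (fun x => `[< forall y, P x y >]).
Proof.
move=> cP; have := dec_not (sigma1_jump (P := fun x y => ~~ P x y) (dec_not cP)).
apply: comp_ext => x; congr (nat_of_bool _); rewrite -asbool_neg.
apply/asbool_equiv_eq; split=> [H y|H [y /negP//]].
by apply: contrapT => /negP nP; apply: H; exists y.
Qed.

(** The graph of [A] is an existential question with a vacuous witness, and [A x] is found by
    searching through it. *)
Lemma comp_jump A : computable_in (jump A) A.
Proof.
have cA : decidable_in A (fun p => A (fstn p) == sndn p).
  by have cO := comp_oracle A; comp.
apply: (@comp_mu _ (fun x y => A x == y)); last 2 first.
- by move=> x; rewrite eqxx.
- by move=> x m; rewrite neq_ltn orbC => ->.
have := sigma1_jump (P := fun p _ => A (fstn p) == sndn p).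
have cB : decidable_in A (fun p => A (fstn (fstn p)) == sndn (fstn p)).
  by have cO := comp_oracle A; comp.
move=> /(_ _ cB); apply: comp_ext => p; congr (nat_of_bool _).
by apply/asboolP/idP => [[]|]; [|exists 0].
Qed.

Lemma comp_jumpW A f : computable_in A f -> computable_in (jump A) f.
Proof. exact: comp_trans (comp_jump A). Qed.

(** By the normal form, the jump of [A] is existential over a matrix decidable in [A], hence in
    [B]. *)
Lemma jump_mono A B : computable_in B A -> computable_in (jump B) (jump A).
Proof.
move=> cA; have := sigma1_jump (A := B) (P := fun e l => halts A e (ldec l)).
have -> : jump A = fun e => `[< exists l, halts A e (ldec l) >].
  apply/funext => e; rewrite jumpE; congr (nat_of_bool _); apply/asbool_equiv_eq.
  by split=> [[L H]|[l H]]; [exists (lcode L); rewrite lcodeK|exists (ldec l)].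
apply; apply: dec_halts; try by comp.
Qed.

(** * The low basis theorem *)

(** Bit strings are coded by numbers, lowest bit first, so that all strings of length [n] occur
    among the numbers below [2 ^ n]. *)
Definition bit (s i : nat) : bool := odd (iter i half s).

Fixpoint bits_num (b : nat -> bool) (n : nat) : nat :=
  if n is m.+1 then b 0 + (bits_num (fun i => b i.+1) m).*2 else 0.

Lemma bit_num b n i : i < n -> bit (bits_num b n) i = b i.
Proof.
elim: n b i => // n IH b [|i] ltin; first by rewrite /bit /= oddD odd_double addbF oddb.
by rewrite /bit iterSr /= half_bit_double -/(bit _ _) IH.
Qed.

Lemma bits_num_lt b n : bits_num b n < 2 ^ n.
Proof.
by elim: n b => //= n IH b; rewrite expnS; have := IH (fun i => b i.+1); case: (b 0); lia.
Qed.

Lemma comp_half A f : computable_in A f -> computable_in A (fun x => (f x)./2).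
Proof.
move=> cf; apply: (@comp_ext _ (fun x => iteri (f x) (fun m z => odd m + z) 0)).
  by move=> x; elim: (f x) => //= m ->; rewrite uphalf_half.
by comp.
Qed.

Lemma dec_bit A s i : computable_in A s -> computable_in A i ->
  decidable_in A (fun x => bit (s x) (i x)).
Proof.
move=> cs ci; apply: comp_odd; apply: (@comp_iter _ i (fun _ => half)) => //.
exact: comp_half (comp_snd A).
Qed.

(** Weak Koenig's lemma, [P n] being level [n] of the tree: [next] prolongs a string that has
    extensions at every level, preferring [true] whenever this property survives. *)
Lemma konig (P : nat -> (nat -> bool) -> Prop) :
  (forall n b b', (forall i, i < n -> b i = b' i) -> P n b -> P n b') ->
  (forall m n b, m <= n -> P n b -> P m b) ->
  (forall n, exists b, P n b) ->
  exists X, forall n, P n X.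
Proof.
move=> Pagree Pdecr Pne.
pose ext s := forall m, exists2 b, P m b & forall i, i < size s -> b i = nth false s i.
pose next s := rcons s `[< ext (rcons s true) >].
have ext_next s : ext s -> ext (next s).
  move=> es; rewrite /next; case: asboolP => // nt.
  have {nt}[m1 nt] : exists m, ~ exists2 b, P m b & forall i, i < size (rcons s true) ->
      b i = nth false (rcons s true) i by apply/existsNP.
  (* No extension of [s] by [true] exists at level [m1], so one at a level above both [m] and [m1]
     continues with [false]. *)
  move=> m; have [b Pb bs] := es (maxn m m1).
  exists b; first by apply: Pdecr Pb; apply: leq_maxl.
  move=> i; rewrite size_rcons ltnS leq_eqVlt nth_rcons => /orP[/eqP -> {i}|lti]; last first.
    by rewrite lti bs.
  rewrite ltnn eqxx; case bE: (b (size s)) => //; case: nt; exists b.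
    by apply: Pdecr Pb; apply: leq_maxr.
  move=> i; rewrite size_rcons ltnS leq_eqVlt nth_rcons => /orP[/eqP -> |lti].
    by rewrite ltnn eqxx.
  by rewrite lti bs.
pose pre n := iter n next [::].
have ext_pre n : ext (pre n).
  elim: n => [|n IH] /=; last exact: ext_next.
  by move=> m; have [b] := Pne m; exists b.
have size_pre n : size (pre n) = n by elim: n => //= n IH; rewrite size_rcons IH.
have nth_pre n i : i < n -> nth false (pre n) i = nth false (pre i.+1) i.
  elim: n => // n IH; rewrite ltnS leq_eqVlt => /orP[/eqP -> //|lti].
  by rewrite -(IH lti) /= nth_rcons size_pre lti.
exists (fun i => nth false (pre i.+1) i) => n.
have [b Pb bE] := ext_pre n n; apply: Pagree Pb => i lti.
by rewrite bE ?size_pre // nth_pre.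
Qed.

Definition join (X : nat -> bool) (A : nat -> nat) : nat -> nat :=
  fun x => pairn (X x) (A x).

(** The bound [n] on the derivation also bounds its oracle queries, so this is a property of the
    first [n] bits of [b]. *)
Definition halts_below (A : nat -> nat) (e n : nat) (b : nat -> bool) : bool :=
  has (fun l => halts (join b A) e (ldec l)) (iota 0 n).

Lemma halts_below_mono A e m n b : m <= n -> halts_below A e m b -> halts_below A e n b.
Proof.
move=> mn /hasP[l]; rewrite mem_iota => lm Hl; apply/hasP; exists l => //.
by rewrite mem_iota; lia.
Qed.

Lemma halts_below_agree A e n b b' : (forall i, i < n -> b i = b' i) ->
  halts_below A e n b = halts_below A e n b'.
Proof.
move=> bb; apply: eq_in_has => l; rewrite mem_iota => lm; apply: halts_agree => x.
by rewrite ldecK => lx; rewrite /join bb //; lia.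
Qed.

Lemma jump_halts_below A e X :
  jump (join X A) e = `[< exists n, halts_below A e n X >].
Proof.
rewrite jumpE; congr (nat_of_bool _); apply/asbool_equiv_eq; split.
  move=> [L HL]; exists (lcode L).+1; apply/hasP; exists (lcode L).
    by rewrite mem_iota /=.
  by rewrite lcodeK.
by move=> [n /hasP[l _ Hl]]; exists (ldec l).
Qed.

(* The forcing sequence: at step [e] the tree is thinned out to the strings that
   do not make program [e] halt, unless this leaves only finitely many strings. *)
Fixpoint thin (A : nat -> nat) (Q : nat -> (nat -> bool) -> bool)
    (e n : nat) (b : nat -> bool) : bool :=
  if e is j.+1 then
    thin A Q j n b &&
    (`[< exists m, forall c, thin A Q j m c -> halts_below A j m c >]
     || ~~ halts_below A j n b)
  else Q n b.

(** At some level every surviving string makes program [e] halt; this will be the value at [e] of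
    the jump of the path. *)
Definition forced (A : nat -> nat) (Q : nat -> (nat -> bool) -> bool) (e : nat) : bool :=
  `[< exists m, forall c, thin A Q e m c -> halts_below A e m c >].

Lemma thinE A Q e n b : thin A Q e n b =
  Q n b && all (fun j => forced A Q j || ~~ halts_below A j n b) (iota 0 e).
Proof.
elim: e => [|e IH]; first by rewrite andbT.
by rewrite -[in RHS]addn1 iotaD all_cat add0n /= -/(forced A Q e) IH andbT andbA.
Qed.

Section LowBasis.
Variables (A : nat -> nat) (Q : nat -> (nat -> bool) -> bool).
Hypothesis Qagree : forall n b b', (forall i, i < n -> b i = b' i) -> Q n b -> Q n b'.
Hypothesis Qdecr : forall m n b, m <= n -> Q n b -> Q m b.
Hypothesis Qne : forall n, exists b, Q n b.

Lemma thin_agree e n b b' : (forall i, i < n -> b i = b' i) ->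
  thin A Q e n b -> thin A Q e n b'.
Proof.
move=> bb; rewrite !thinE => /andP[/(Qagree bb) -> /allP H]; apply/allP => j /H.
by rewrite (halts_below_agree _ _ bb).
Qed.

Lemma thin_decr d e m n b : d <= e -> m <= n -> thin A Q e n b -> thin A Q d m b.
Proof.
move=> de mn; rewrite !thinE => /andP[/(Qdecr mn) -> /allP H]; apply/allP => j jd.
have /H/orP[-> //|nh] : j \in iota 0 e by move: jd; rewrite !mem_iota; lia.
by rewrite (contra (halts_below_mono mn) nh) orbT.
Qed.

(** A step shrinks the tree only if [e] is not forced, and then every level has a surviving string
    that does not make the program halt. *)
Lemma thin_ne e n : exists b, thin A Q e n b.
Proof.
elim: e n => [|e IH] n; first exact: Qne.
case: (boolP (forced A Q e)) => [fe|/asboolPn nf].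
  by have [b Hb] := IH n; exists b; rewrite /= Hb -/(forced A Q e) fe.
have [b [Hb Hn]] : exists b, thin A Q e n b /\ ~ halts_below A e n b.
  apply: contrapT => H; apply: nf; exists n => c tc; apply: contrapT => nh.
  by apply: H; exists c.
by exists b; rewrite /= Hb; move/negP: Hn => ->; rewrite orbT.
Qed.

Lemma thin_path : exists X, forall e n, thin A Q e n X.
Proof.
(* [thin] decreases in both indices, so a path through the diagonal levels lies in all the trees. *)
have [||n|X HX] := @konig (fun n b => thin A Q n n b).
- by move=> n b b'; apply: thin_agree.
- by move=> m n b mn; apply: thin_decr.
- exact: thin_ne.
exists X => e n; apply: thin_decr (HX (maxn e n)); [exact: leq_maxl|exact: leq_maxr].
Qed.

(** If program [e] halted along [X] without being forced, [X] would have been removed from tree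
    [e.+1]. *)
Lemma jump_thin_path X : (forall e n, thin A Q e n X) ->
  forall e, jump (join X A) e = forced A Q e.
Proof.
move=> HX e; rewrite jump_halts_below; congr nat_of_bool; apply/asboolP/idP.
  move=> [n Hn]; have := HX e.+1 n; rewrite thinE => /andP[_ /allP/(_ e)].
  by rewrite mem_iota /= Hn orbF; apply.
by move=> /asboolP[m Hm]; exists m; apply: Hm.
Qed.

(* [t] stands for the first [e] values of [forced A Q]. *)
Definition forced_from (t e : nat) : bool :=
  `[< exists m, all (fun s =>
    (Q m (bit s) && all (fun j => bit t j || ~~ halts_below A j m (bit s)) (iota 0 e))
    ==> halts_below A e m (bit s)) (iota 0 (2 ^ m)) >].

(** Level [m] depends only on the first [m] bits, so sequences may be replaced by the numbers below
    [2 ^ m]; this leaves a single unbounded quantifier. *)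
Lemma forced_fromE t e : (forall j, j < e -> bit t j = forced A Q j) ->
  forced_from t e = forced A Q e.
Proof.
move=> tE; have thinb m b : thin A Q e m b =
    Q m b && all (fun j => bit t j || ~~ halts_below A j m b) (iota 0 e).
  rewrite thinE; congr andb; apply: eq_in_all => j; rewrite mem_iota => je.
  by rewrite tE.
apply/asbool_equiv_eq; split=> -[m Hm]; exists m.
  move=> c tc; have bc : forall i, i < m -> c i = bit (bits_num c m) i.
    by move=> i im; rewrite bit_num.
  rewrite (halts_below_agree _ _ bc); move/allP: Hm => /(_ (bits_num c m)).
  by rewrite mem_iota bits_num_lt -thinb (thin_agree bc tc); apply.
by apply/allP => s _; rewrite -thinb; apply/implyP; apply: Hm.
Qed.

End LowBasis.

Lemma dec_halts_below B A e n s : computable_in B A ->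
  computable_in B e -> computable_in B n -> computable_in B s ->
  decidable_in B (fun x => halts_below A (e x) (n x) (bit (s x))).
Proof.
move=> cA ce cn cs.
apply: (@dec_has_iota _ _ (fun x l => halts (join (bit (s x)) A) (e x) (ldec l))) => //.
apply: (@dec_halts _ (fun p => join (bit (s (fstn p))) A)); try by comp.
by rewrite /join; apply: comp_pairn; [apply: dec_bit|]; comp.
Qed.

Lemma dec_forced_from A Q : decidable_in A (fun p => Q (fstn p) (bit (sndn p))) ->
  decidable_in (jump A) (fun p => forced_from A Q (fstn p) (sndn p)).
Proof.
move=> Qdec.
have ch : decidable_in A (fun p =>
    halts_below A (fstn p) (fstn (sndn p)) (bit (sndn (sndn p)))).
  by apply: dec_halts_below; [exact: comp_oracle| | |]; comp.
have cb := dec_bit (comp_fst A) (comp_snd A).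
pose Q' m s := Q m (bit s); pose h e m s := halts_below A e m (bit s).
have {}Qdec : decidable_in A (fun p => Q' (fstn p) (sndn p)) := Qdec.
have {}ch : decidable_in A (fun p => h (fstn p) (fstn (sndn p)) (sndn (sndn p))) := ch.
apply: (@sigma1_jump _ (fun p m => all (fun s =>
    (Q' m s && all (fun j => bit (fstn p) j || ~~ h j m s) (iota 0 (sndn p)))
    ==> h (sndn p) m s) (iota 0 (2 ^ m)))).
by clearbody Q' h; comp.
Qed.

(** [forced] at [e] depends on its earlier values. A search finds a number [t] whose bits obey this
    recursion below [e], and they are then the true values. *)
Lemma dec_forced A (Q : nat -> (nat -> bool) -> bool) :
  (forall n b b', (forall i, i < n -> b i = b' i) -> Q n b -> Q n b') ->
  decidable_in A (fun p => Q (fstn p) (bit (sndn p))) ->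
  decidable_in (jump A) (forced A Q).
Proof.
move=> Qagree Qdec; have cF := dec_forced_from Qdec.
pose good e t := all (fun j => bit t j == forced_from A Q t j) (iota 0 e).
have good_bit e t : good e t -> forall j, j < e -> bit t j = forced A Q j.
  move=> /allP gt; elim/ltn_ind=> j IH je.
  have /eqP -> : bit t j == forced_from A Q t j by apply: gt; rewrite mem_iota.
  by apply: (forced_fromE Qagree) => i ij; apply: IH => //; apply: ltn_trans je.
have ex_good e : exists t, good e t.
  exists (bits_num (forced A Q) e); apply/allP => j; rewrite mem_iota /= => je.
  rewrite bit_num // (forced_fromE Qagree) // => i ij.
  by rewrite bit_num //; apply: ltn_trans je.
apply: (@comp_ext _ (fun e => forced_from A Q (ex_minn (ex_good e)) e)) => [e|].
  congr nat_of_bool; apply: (forced_fromE Qagree) => j je.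
  by case: ex_minnP => t /good_bit gt _; apply: gt.
have cb := dec_bit (comp_fst (jump A)) (comp_snd (jump A)).
have cm : computable_in (jump A) (fun e => ex_minn (ex_good e)).
  by apply: (@comp_ex_minn _ good); rewrite /good; comp.
by pose g e := ex_minn (ex_good e); rewrite -/(g _) in cm *; clearbody g; comp.
Qed.

Lemma low_basis A (Q : nat -> (nat -> bool) -> bool) :
  (forall n b b', (forall i, i < n -> b i = b' i) -> Q n b -> Q n b') ->
  (forall m n b, m <= n -> Q n b -> Q m b) ->
  (forall n, exists b, Q n b) ->
  decidable_in A (fun p => Q (fstn p) (bit (sndn p))) ->
  exists2 X, (forall n, Q n X) & computable_in (jump A) (jump (join X A)).
Proof.
move=> Qagree Qdecr Qne Qdec; have [X HX] := @thin_path A Q Qagree Qdecr Qne.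
exists X => [n|]; first exact: (HX 0 n).
by apply: comp_ext (dec_forced Qagree Qdec) => e; rewrite (jump_thin_path HX).
Qed.

(** * Low_2 cohesive sequences *)

(* Finite strings of values are kept in reverse order, so that [cons] extends
   them; [string_fun G] reads such a string as a function. *)
Definition string_fun (G : seq nat) (x : nat) : nat := nth 0 G (size G - x.+1).

Lemma string_fun_cat E G x : x < size G -> string_fun (E ++ G) x = string_fun G x.
Proof.
move=> xG; rewrite /string_fun size_cat nth_cat.
by rewrite ifF; [congr nth; lia|apply/negbTE; rewrite -leqNgt; lia].
Qed.

Definition in_cell (R : nat -> nat -> bool) (n : nat) (b : nat -> bool) (i : nat) : bool :=
  all (fun m => R m i == b m) (iota 0 n).

Lemma in_cell_le R m n b i : m <= n -> in_cell R n b i -> in_cell R m b i.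
Proof.
move=> mn /allP H; apply/allP => j; rewrite mem_iota => jm; apply: H.
by rewrite mem_iota; lia.
Qed.

Lemma in_cell_agree R n b b' i : (forall m, m < n -> b m = b' m) ->
  in_cell R n b i = in_cell R n b' i.
Proof.
by move=> bb; apply: eq_in_all => m; rewrite mem_iota => mn; rewrite bb.
Qed.

(* [g] extends the condition [f] within the cell of the string [t] of length [e]
   and makes program [e] halt. *)
Definition good_ext (R : nat -> nat -> bool) (e t f g : nat) : bool :=
  [&& size (ldec f) <= size (ldec g),
      drop (size (ldec g) - size (ldec f)) (ldec g) == ldec f,
      all (fun j => nth 0 (ldec g) j.+1 < nth 0 (ldec g) j) (iota 0 (size (ldec g)).-1),
      all (fun j => in_cell R e (bit t) (nth 0 (ldec g) j))
          (iota 0 (size (ldec g) - size (ldec f))) &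
      has (fun l => halts (string_fun (ldec g)) e (ldec l)) (iota 0 (size (ldec g)))].

Lemma dec_in_cell A R n t i : decidable_in A (fun p => R (fstn p) (sndn p)) ->
  computable_in A n -> computable_in A t -> computable_in A i ->
  decidable_in A (fun x => in_cell R (n x) (bit (t x)) (i x)).
Proof.
move=> cR cn ct ci; have cb := dec_bit (comp_fst A) (comp_snd A).
by rewrite /in_cell; comp.
Qed.

Lemma dec_good_ext A R e t f g : decidable_in A (fun p => R (fstn p) (sndn p)) ->
  computable_in A e -> computable_in A t -> computable_in A f -> computable_in A g ->
  decidable_in A (fun x => good_ext R (e x) (t x) (f x) (g x)).
Proof.
move=> cR ce ct cf cg; rewrite /good_ext.
apply: dec_and; first by comp.
apply: dec_and; first by comp.
apply: dec_and; first by comp.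
apply: dec_and.
  apply: (@dec_all_iota _ _ (fun x j => in_cell R (e x) (bit (t x)) (nth 0 (ldec (g x)) j))).
    by comp.
  by apply: dec_in_cell; comp.
apply: (@dec_has_iota _ _ (fun x l => halts (string_fun (ldec (g x))) (e x) (ldec l))).
  by comp.
apply: (@dec_halts _ (fun p => string_fun (ldec (g (fstn p))))); try by comp.
by rewrite /string_fun; comp.
Qed.

Definition extension (R : nat -> nat -> bool) (X : nat -> bool) (e : nat)
    (F G : seq nat) : Prop :=
  exists2 E, G = E ++ F & all (in_cell R e X) E.

Lemma extension_trans R X d e F G H : d <= e ->
  extension R X d F G -> extension R X e G H -> extension R X d F H.
Proof.
move=> de [E -> aE] [E' -> aE']; exists (E' ++ E); first by rewrite catA.
rewrite all_cat aE andbT; apply: sub_all aE' => i; exact: in_cell_le.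
Qed.

Lemma sorted_gtnP G :
  reflect (sorted gtn G)
    (all (fun j => nth 0 G j.+1 < nth 0 G j) (iota 0 (size G).-1)).
Proof.
apply: (iffP allP) => [H|/(sortedP 0) H i]; last by rewrite mem_iota => iG; apply: H; lia.
by apply/(sortedP 0) => i iG; apply: H; rewrite mem_iota; lia.
Qed.

(** The derivation is bounded by the length of the string, so its queries stay inside the string and
    halting survives in every extension. *)
Lemma good_extP R X e t f g : (forall m, m < e -> bit t m = X m) ->
  good_ext R e t f g <->
  [/\ extension R X e (ldec f) (ldec g), sorted gtn (ldec g) &
      exists2 l, l < size (ldec g) & halts (string_fun (ldec g)) e (ldec l)].
Proof.
move=> tX; rewrite /good_ext; split.
  case/and5P => szl /eqP fE /sorted_gtnP sg /allP cg /hasP[l]; rewrite mem_iota => lg Hl.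
  split=> //; last by exists l.
  exists (take (size (ldec g) - size (ldec f)) (ldec g)).
    by rewrite -{2}fE cat_take_drop.
  apply/(all_nthP 0) => j; rewrite size_take_min => jl; rewrite nth_take; last by lia.
  by rewrite -(in_cell_agree _ _ tX); apply: cg; rewrite mem_iota; lia.
move=> [[E gE aE] sg [l lg Hl]]; apply/and5P; split.
- by rewrite gE size_cat leq_addl.
- by rewrite gE size_cat addnK drop_size_cat.
- exact/sorted_gtnP.
- rewrite gE size_cat addnK; apply/allP => j; rewrite mem_iota => jE.
  rewrite nth_cat ifT // (in_cell_agree _ _ tX); move/(all_nthP 0): aE; exact.
- by apply/hasP; exists l => //; rewrite mem_iota.
Qed.

(** * Mathias forcing inside the cells of a path *)

Section Mathias.
Variables (R : nat -> nat -> bool) (X : nat -> bool) (B : nat -> nat).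
Hypothesis cR : decidable_in zero_deg (fun p => R (fstn p) (sndn p)).
Hypothesis cX : decidable_in B X.
Hypothesis cB : computable_in B (jump zero_deg).
Hypothesis cellX : forall n, exists2 i, n <= i & in_cell R n X i.

Let prefix_ex e : exists t, all (fun m => bit t m == X m) (iota 0 e).
Proof.
exists (bits_num X e); apply/allP => m; rewrite mem_iota => me.
by rewrite bit_num.
Qed.

(** The question [ask] is put to [0'], which does not know [X]; it receives the finitely many
    relevant bits as a number. *)
Let prefix e := ex_minn (prefix_ex e).

Let prefixP e m : m < e -> bit (prefix e) m = X m.
Proof.
rewrite /prefix; case: ex_minnP => t /allP H _ me; apply/eqP/H.
by rewrite mem_iota.
Qed.

Let ask e f := `[< exists g, good_ext R e (prefix e) f g >].

(** Both answers are covered by one formula, so that a single total search computes [grow]. *)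
Let grow_ex e f :
  exists g, if ask e f then good_ext R e (prefix e) f g else g == f.
Proof. by case: (boolP (ask e f)) => [/asboolP|_]; [|exists f]. Qed.

Let grow e f := ex_minn (grow_ex e f).

Let next_ex e g : exists i, (head 0 (ldec g) < i) && in_cell R e X i.
Proof.
have [i iE ci] := cellX (maxn e (head 0 (ldec g)).+1).
exists i; rewrite (in_cell_le _ ci) ?leq_maxl // andbT.
by rewrite (leq_trans _ iE) // leq_maxr.
Qed.

Let next e g := ex_minn (next_ex e g).

(** The chain of conditions starts from [0], the empty string. Step [e] settles program [e], then
    adds one value so that the limit is total. *)
Let state n := iteri n (fun e f => lcode (next e (grow e f) :: ldec (grow e f))) 0.

Let growP e f : extension R X e (ldec f) (ldec (grow e f)) /\
  (sorted gtn (ldec f) -> sorted gtn (ldec (grow e f))) /\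
  (ask e f -> good_ext R e (prefix e) f (grow e f)).
Proof.
rewrite /grow; case: ex_minnP => g; case: ifP => // [_ gg _|_ /eqP -> _]; last first.
  by split=> //; exists [::].
have [eg sg _] := (good_extP R f g (@prefixP e)).1 gg.
by split.
Qed.

Let stateS n : ldec (state n.+1) = next n (grow n (state n)) :: ldec (grow n (state n)).
Proof. exact: (lcodeK (_ :: _)). Qed.

Let state_extS n : extension R X n (ldec (state n)) (ldec (state n.+1)).
Proof.
apply: (extension_trans (leqnn n)) (growP n (state n)).1 _.
rewrite stateS; exists [:: next n (grow n (state n))] => //=.
by rewrite /next; case: ex_minnP => i /andP[_ ->].
Qed.

Let state_sorted n : sorted gtn (ldec (state n)).
Proof.
elim: n => // n /(growP n (state n)).2.1; rewrite stateS.
rewrite /next; case: ex_minnP => i /andP[hi _] _.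
by case: (ldec _) hi => //= a s -> ->.
Qed.

Let state_ext m n : m <= n -> extension R X m (ldec (state m)) (ldec (state n)).
Proof.
elim: n => [|n IH]; first by rewrite leqn0 => /eqP ->; exists [::].
rewrite leq_eqVlt => /orP[/eqP ->|mn]; first by exists [::].
by apply: extension_trans (IH mn) (state_extS n).
Qed.

Let state_size n : n <= size (ldec (state n)).
Proof.
elim: n => // n IH; rewrite stateS /= ltnS (leq_trans IH) //.
by have [[E -> _] _] := growP n (state n); rewrite size_cat leq_addl.
Qed.

(** Stage [x.+1] has more than [x] values, so value [x] is fixed by then. *)
Let f x := string_fun (ldec (state x.+1)) x.

Let f_state n x : x < size (ldec (state n)) -> f x = string_fun (ldec (state n)) x.
Proof.
move=> xn; rewrite /f; case: (leqP n x.+1) => [le|/ltnW le].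
  by have [E -> _] := state_ext le; rewrite string_fun_cat.
by have [E -> _] := state_ext le; rewrite string_fun_cat // state_size.
Qed.

Let f_incr x : f x < f x.+1.
Proof.
have sz := state_size x.+2.
rewrite !(@f_state x.+2) //; last by apply: leq_trans sz.
have /(sortedP 0)/(_ (size (ldec (state x.+2)) - x.+2)) H := state_sorted x.+2.
rewrite /string_fun.
have -> : size (ldec (state x.+2)) - x.+1 = (size (ldec (state x.+2)) - x.+2).+1 by lia.
by apply: H; lia.
Qed.

(** Values beyond the string of stage [n] were added later, hence inside cell [n]. *)
Let f_cell n v : size (ldec (state n)) <= v -> in_cell R n X (f v).
Proof.
move=> sv; have vn : n <= v.+1 by have := state_size n; lia.
have [E sE aE] := state_ext vn; rewrite /f /string_fun sE size_cat.
have := state_size v.+1; rewrite sE size_cat => szv.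
by rewrite nth_cat ifT; [move/(all_nthP 0): aE; apply|]; lia.
Qed.

(** If program [e] halts with oracle [f], a late stage is itself a good extension, so the answer was
    yes. Conversely, the extension chosen after a yes is part of [f]. *)
Let jump_f e : jump f e = ask e (state e).
Proof.
rewrite jumpE; congr nat_of_bool; apply/asboolP/idP.
  move=> [L HL]; apply/asboolP.
  (* Late enough to extend stage [e] and to contain all values that [L] queries. *)
  pose n := maxn e (lcode L).+1; exists (state n); apply/(good_extP _ _ _ (@prefixP e)).
  have sz := state_size n; split=> //; first by apply: state_ext; apply: leq_maxl.
  have Ln : lcode L < size (ldec (state n)) by lia.
  exists (lcode L) => //; rewrite lcodeK (halts_agree (o' := f)) // => x xL.
  by rewrite -f_state //; lia.
move=> /(growP e (state e)).2.2 /(good_extP _ _ _ (@prefixP e))[_ _ [l lg Hl]].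
exists (ldec l); rewrite (halts_agree (o' := string_fun (ldec (grow e (state e))))) //.
move=> x; rewrite ldecK => xl; rewrite (@f_state e.+1) stateS.
  by rewrite -cat1s string_fun_cat //; lia.
by rewrite /=; lia.
Qed.

Let comp_prefix : computable_in B prefix.
Proof.
have cX' := cX; have cb := dec_bit (comp_fst B) (comp_snd B).
have cP : decidable_in B (fun p => all (fun m => bit (sndn p) m == X m) (iota 0 (fstn p))).
  by clear cR cX cB; comp.
exact: (comp_ex_minn prefix_ex cP).
Qed.

(** The matrix is decidable without oracle, so [0'] answers the question; [X] enters only through
    the argument [prefix]. *)
Let dec_ask : decidable_in B (fun p => ask (fstn p) (sndn p)).
Proof.
have c0 : decidable_in zero_deg (fun p => good_ext R (fstn (fstn p)) (fstn (sndn (fstn p)))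
    (sndn (sndn (fstn p))) (sndn p)).
  by apply: dec_good_ext => //; clear cR cX cB; comp.
have := sigma1_jump (P := fun q g => good_ext R (fstn q) (fstn (sndn q)) (sndn (sndn q)) g) c0.
move=> /(comp_trans cB) H.
have cq : computable_in B (fun p => pairn (fstn p) (pairn (prefix (fstn p)) (sndn p))).
  by have cp := comp_prefix; clearbody prefix; clear -cp; comp.
apply: comp_ext (comp_comp H cq) => p; congr nat_of_bool.
by rewrite /ask !pairE.
Qed.

Let cRB : decidable_in B (fun p => R (fstn p) (sndn p)).
Proof. exact: comp_trans (comp_const B 0) cR. Qed.

Let comp_grow : computable_in B (fun p => grow (fstn p) (sndn p)).
Proof.
have ca := dec_ask; have cp := comp_prefix.
apply: (@comp_ex_minn _ (fun p g => if ask (fstn p) (sndn p)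
  then good_ext R (fstn p) (prefix (fstn p)) (sndn p) g else g == sndn p)
  (fun p => grow_ex (fstn p) (sndn p))).
have cg : decidable_in B (fun q => good_ext R (fstn (fstn q)) (prefix (fstn (fstn q)))
    (sndn (fstn q)) (sndn q)).
  by apply: dec_good_ext => //; clearbody prefix; clear -cp; comp.
apply: dec_if => //; last by clear; comp.
exact: (comp_comp ca (comp_fst B)).
Qed.

Let comp_next : computable_in B (fun p => next (fstn p) (sndn p)).
Proof.
have cR' := cRB; have cX' := cX.
apply: (@comp_ex_minn _ (fun p i => (head 0 (ldec (sndn p)) < i) && in_cell R (fstn p) X i)
  (fun p => next_ex (fstn p) (sndn p))).
apply: dec_and; first by clear; comp.
by rewrite /in_cell; clear cR cX cB; comp.
Qed.

Let comp_state : computable_in B state.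
Proof.
have cg := comp_grow; have cn := comp_next.
rewrite /state; clearbody grow next; clear cR cX cB.
by comp.
Qed.

Let comp_jump_f : computable_in B (jump f).
Proof.
have cs := comp_state; have ca := dec_ask.
apply: (@comp_ext _ (fun e => ask e (state e))) => [e|]; first by rewrite jump_f.
by clearbody state ask; clear cR cX cB; comp.
Qed.

Lemma mathias : exists f : nat -> nat,
  [/\ forall x, f x < f x.+1, computable_in B (jump f) &
      forall n, exists s, forall v, s <= v -> in_cell R n X (f v)].
Proof.
exists f; split=> // n; exists (size (ldec (state n))) => v; exact: f_cell.
Qed.

End Mathias.

Lemma cohesive_low2 (R : nat -> nat -> bool) :
  decidable_in zero_deg (fun p => R (fstn p) (sndn p)) ->
  exists f : nat -> nat, [/\ increasing_seq f, low2 f &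
    forall m, exists s, forall v w, s <= v -> s <= w -> R m (f v) = R m (f w)].
Proof.
move=> cR; pose K := jump zero_deg.
(* Each level only asks for one element beyond [n], an existential question for [0']; along a path
   all levels together make every cell infinite. *)
pose Q n b := `[< exists i, (n <= i) && in_cell R n b i >].
have [||n||X QX lowX] := @low_basis K Q.
- move=> n b b' bb /asboolP[i Hi]; apply/asboolP; exists i.
  by rewrite -(in_cell_agree _ _ bb).
- move=> m n b mn /asboolP[i /andP[ni ci]]; apply/asboolP; exists i.
  by rewrite (leq_trans mn ni) (in_cell_le mn ci).
(* The index [n] lies in the cell that it determines itself. *)
- exists (fun m => R m n); apply/asboolP; exists n; rewrite leqnn.
  by apply/allP => m _ /=.
- apply: (@sigma1_jump _ (fun p i => (fstn p <= i) && in_cell R (fstn p) (bit (sndn p)) i)).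
  by apply: dec_and; [comp|apply: dec_in_cell; comp].
pose B := join X K.
have cX : decidable_in B X.
  apply: comp_ext (comp_comp (comp_fst B) (comp_oracle B)) => x.
  by rewrite /B /join pairE.
have cK : computable_in B K.
  apply: comp_ext (comp_comp (comp_snd B) (comp_oracle B)) => x.
  by rewrite /B /join pairE.
have [n|f [f_incr cf f_cell]] := @mathias R X B cR cX cK.
  have /asboolP[i /andP[ni ci]] := QX n; by exists i.
exists f; split.
- by apply: leq_mono; apply: homo_ltn => //; apply: ltn_trans.
(* The other reduction chains the jump of [f] below [B] with the lowness of [X] over [K]. *)
- split; first exact/jump_mono/jump_mono/comp_const.
  exact: comp_trans lowX (jump_mono cf).
- move=> m; have [s Hs] := f_cell m.+1; exists s => v w /Hs/allP cv /Hs/allP cw.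
  have /cv/eqP -> : m \in iota 0 m.+1 by rewrite mem_iota /=.
  by apply/esym/eqP/cw; rewrite mem_iota /=.
Qed.

(** * From cohesive to Cauchy sequences *)

(** Denominators are multiplied out and negative parts moved across, so that only arithmetic of
    natural numbers occurs. *)
Definition rat_code_lt (a b : nat) : bool :=
  fstn a * (sndn (sndn b)).+1 + fstn (sndn b) * (sndn (sndn a)).+1
  < fstn b * (sndn (sndn a)).+1 + fstn (sndn a) * (sndn (sndn b)).+1.

Lemma rat_code_ltE a b : rat_code_lt a b = (rat_of_nat a < rat_of_nat b)%R.
Proof.
rewrite /rat_code_lt /rat_of_nat; move: (fstn a) (fstn b) => p p'.
move: (sndn (sndn a)) (sndn (sndn b)) (fstn (sndn a)) (fstn (sndn b)) => d d' s s'.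
rewrite ltr_pdivrMr ?ltr0n // mulrAC ltr_pdivlMr ?ltr0n // !mulrBl.
by rewrite ltrBlDr addrAC ltrBrDr -!natrM -!natrD ltr_nat.
Qed.

Local Open Scope ring_scope.

(** On a grid of mesh [2 ^- n], a larger gap would leave room for a grid point that separates [a]
    from [b]. *)
Lemma grid_close (R : realType) (N n : nat) (a b : R) :
  `|a| <= N%:R -> `|b| <= N%:R ->
  (forall j : nat, (j < (2 * N * 2 ^ n).+1)%N ->
    (a < (j%:R - (N * 2 ^ n)%:R) / (2 ^ n)%:R) =
    (b < (j%:R - (N * 2 ^ n)%:R) / (2 ^ n)%:R)) ->
  b - a <= 2 ^- n.
Proof.
rewrite !ler_norml => /andP[a1 a2] /andP[b1 b2] H; rewrite leNgt; apply/negP => ab.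
pose p : R := (2 ^ n)%:R.
have p0 : 0 < p by rewrite ltr0n expn_gt0.
have pV : p^-1 = 2 ^- n by rewrite /p natrX.
have u0 : 0 <= (a + N%:R) * p by rewrite mulr_ge0 ?(ltW p0) //; lra.
(* [j] is the index of the first grid point above [a]. *)
have /andP[t1 t2] := truncn_itv u0; set j := (Num.truncn _).+1 in t2.
have jb : j%:R < (b + N%:R) * p.
  have : j%:R <= (a + N%:R) * p + 1 by rewrite /j -natr1; lra.
  move/le_lt_trans; apply; rewrite -pV in ab.
  have : 1 < (b - a) * p by rewrite -ltr_pdivrMr // div1r.
  by lra.
have jN : (j < (2 * N * 2 ^ n).+1)%N.
  rewrite ltnS -(ler_nat R) (le_trans (ltW jb)) // !natrM -/p.
  by rewrite ler_pM2r //; lra.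
have := H j jN; rewrite !ltr_pdivlMr // natrM -/p.
have -> : a * p < j%:R - N%:R * p by lra.
by move/esym; rewrite ltNge; apply/negP; rewrite negbK; lra.
Qed.

Lemma eventually_all (P : nat -> nat -> nat -> Prop) J :
  (forall j, exists s, forall v w, (s <= v)%N -> (s <= w)%N -> P j v w) ->
  exists s, forall v w, (s <= v)%N -> (s <= w)%N -> forall j, (j < J)%N -> P j v w.
Proof.
move=> H; elim: J => [|J [s Hs]]; first by exists 0.
have [t Ht] := H J; exists (maxn s t) => v w; rewrite !geq_max => /andP[sv tv] /andP[sw tw] j.
by rewrite ltnS leq_eqVlt => /orP[/eqP ->|]; [apply: Ht|apply: Hs].
Qed.

Lemma bounded_fun_nat (R : realType) (x : nat -> R) : bounded_fun x ->
  exists N : nat, forall i, `|x i| <= N%:R.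
Proof.
move=> [M [_ HM]]; exists (Num.bound (`|M| + 1)) => i.
have := HM (`|M| + 1); rewrite (le_lt_trans (ler_norm M)) ?ltrDl ?ltr01 //.
move=> /(_ isT i Logic.I)/le_trans; apply; apply/ltW/archi_boundP.
by rewrite addr_ge0.
Qed.

Lemma low2_cauchy_subseq (R : realType) (x : nat -> R) :
  recursive_seq x -> bounded_fun x ->
  exists f : nat -> nat, [/\ increasing_seq f, low2 f & cauchy_subseq x f].
Proof.
move=> [q cq Hq] /bounded_fun_nat[N HN].
pose S m i := rat_code_lt (q (pairn i (fstn m))) (sndn m).
have [|f [fi fl fS]] := @cohesive_low2 S.
  by rewrite /S /rat_code_lt; have cq' : computable_in zero_deg q := cq; comp.
(* Two approximation errors and one grid gap add up to [3 * 2 ^- n], less than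
   [2 ^- m = 4 * 2 ^- n]. *)
exists f; split=> // m; pose n := m.+2.
(* The name of the [j]-th grid point: names store the denominator minus one, and [N.+1] allows for
   approximations that exceed the bound [N] by at most 1. *)
pose k j := pairn j (pairn (N.+1 * 2 ^ n) (2 ^ n).-1).
have [s Hs] := eventually_all (2 * N.+1 * 2 ^ n).+1 (fun j => fS (pairn n (k j))).
exists s.
suff close v w : (s <= v)%N -> (s <= w)%N -> x (f w) - x (f v) < 2 ^- m.
  move=> v w sv sw; rewrite ltr_norml close // andbT ltrNl opprB.
  exact: close.
move=> sv sw; pose a i : R := ratr (rat_of_nat (q (pairn (f i) n))).
have p2 : 0 < (2 : R) ^- n by rewrite invr_gt0 exprn_gt0.
have p1 : (2 : R) ^- n <= 1 by rewrite invf_le1 ?exprn_gt0 // exprn_ege1 // ler1n.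
have a_near i : `|x (f i) - a i| <= 2 ^- n by apply: Hq.
have a_bnd i : `|a i| <= N.+1%:R.
  have := HN (f i); have := a_near i; rewrite !ler_norml => /andP[? ?] /andP[? ?].
  by rewrite -natr1; apply/andP; split; lra.
have kE j : ratr (rat_of_nat (k j)) = (j%:R - (N.+1 * 2 ^ n)%:R) / (2 ^ n)%:R :> R.
  rewrite /rat_of_nat /k !pairE prednK ?expn_gt0 //.
  by rewrite fmorph_div rmorphB /= !ratr_nat.
have := @grid_close R N.+1 n (a v) (a w) (a_bnd v) (a_bnd w).
have grid j : (j < (2 * N.+1 * 2 ^ n).+1)%N ->
    (a v < (j%:R - (N.+1 * 2 ^ n)%:R) / (2 ^ n)%:R) =
    (a w < (j%:R - (N.+1 * 2 ^ n)%:R) / (2 ^ n)%:R).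
  move=> /(Hs v w sv sw j); rewrite /S !pairE !rat_code_ltE.
  by rewrite -kE !ltr_rat.
move/(_ grid) => wv.
have -> : (2 : R) ^- m = 4 * 2 ^- n by rewrite /n !exprS; field; rewrite expf_neq0.
have := a_near v; have := a_near w; rewrite !ler_norml => /andP[? ?] /andP[? ?].
by lra.
Qed.

Local Close Scope ring_scope.

(** * Diagonalising against 0'-computable functions *)

Definition halting_approx (s e : nat) : nat :=
  has (fun l => halts zero_deg e (ldec l)) (iota 0 s).

Lemma comp_halting_approx A : computable_in A zero_deg ->
  computable_in A (fun p => halting_approx (fstn p) (sndn p)).
Proof.
move=> c0.
apply: (@dec_has_iota _ _ (fun p l => halts zero_deg (sndn p) (ldec l))); first by comp.
by apply: (@dec_halts _ (fun=> zero_deg)); comp.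
Qed.

(** A halting program is recognised once [s] exceeds the code of a derivation, a diverging one
    never; finitely many thresholds have a maximum. *)
Lemma halting_approx_limit n : exists s0, forall s, s0 <= s ->
  forall e, e < n -> halting_approx s e = jump zero_deg e.
Proof.
elim: n => [|n [s0 Hs]]; first by exists 0.
suff [t Ht] : exists t, forall s, t <= s -> halting_approx s n = jump zero_deg n.
  exists (maxn s0 t) => s; rewrite geq_max => /andP[ss ts] e.
  by rewrite ltnS leq_eqVlt => /orP[/eqP ->|]; [apply: Ht|apply: Hs].
rewrite jumpE; case: asboolP => [[L HL]|nL].
  exists (lcode L).+1 => s ls; congr nat_of_bool; apply/hasP; exists (lcode L).
    by rewrite mem_iota.
  by rewrite lcodeK.
exists 0 => s _; rewrite /halting_approx; case: hasP => // -[l _ Hl].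
by case: nL; exists (ldec l).
Qed.

(* The least derivation that is correct for the current approximation decides;
   in the limit this is the least derivation for the halting problem itself. *)
Definition diag_digit (i c : nat) : bool :=
  has (fun l => [&& halts (halting_approx i) c (ldec l),
                    all (fun k => ~~ halts (halting_approx i) c (ldec k)) (iota 0 l) &
                    entry c c 1 \in ldec l]) (iota 0 i).

Lemma dec_diag_digit A : computable_in A zero_deg ->
  decidable_in A (fun p => diag_digit (fstn p) (sndn p)).
Proof.
move=> c0; have ca := comp_halting_approx c0.
have ch : decidable_in A (fun p =>
    halts (halting_approx (fstn p)) (fstn (sndn p)) (ldec (sndn (sndn p)))).
  by apply: (@dec_halts _ (fun p => halting_approx (fstn p))); comp.
pose h i c l := halts (halting_approx i) c (ldec l).
have {}ch : decidable_in A (fun p => h (fstn p) (fstn (sndn p)) (sndn (sndn p))) := ch.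
rewrite /diag_digit /entry -/(h _ _ _).
apply: (@dec_has_iota _ _ (fun p l => [&& h (fstn p) (sndn p) l,
  all (fun k => ~~ h (fstn p) (sndn p) k) (iota 0 l) &
  pairn (sndn p) (pairn (sndn p) 1) \in ldec l])).
  by comp.
by clearbody h; comp.
Qed.

(** A derivation containing [entry c c 1] has a code larger than [c]. Hence each stage has finitely
    many nonzero digits. *)
Lemma diag_digit_ge i c : i <= c -> diag_digit i c = false.
Proof.
move=> ic; apply/negbTE/hasPn => l; rewrite mem_iota => li.
rewrite !negb_and; apply/orP; right; apply/orP; right; apply/negP.
move=> /ltn_mem_lcode; rewrite ldecK.
by have := leq_fstn (entry c c 1); rewrite entry_code; lia.
Qed.

(** Let [c] number a program for [g], and let [l0] be its least derivation from the halting problem.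
    Late stages select [l0], and [entry c c 1] records output 0, so the digit negates the output. *)
Lemma diag_digitP (g : nat -> bool) : decidable_in (jump zero_deg) g ->
  exists c i0, forall i, i0 <= i -> diag_digit i c = ~~ g c.
Proof.
move=> [d Hd]; pose c := encode d; exists c.
have exL : exists l, halts (jump zero_deg) c (ldec l).
  have : jump (jump zero_deg) c = 1.
    rewrite /jump; case: asboolP => // -[]; exists d => //.
    by exists (g c); apply: Hd.
  by rewrite jumpE; case: asboolP => // -[L HL] _; exists (lcode L); rewrite lcodeK.
case: (ex_minnP exL) => l0 Hl0 minl0.
have [s0 Hs] := halting_approx_limit l0.
exists (maxn s0 l0.+1) => i; rewrite geq_max => /andP[si li].
have hE l : l <= l0 ->
    halts (halting_approx i) c (ldec l) = halts (jump zero_deg) c (ldec l).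
  move=> ll; apply: halts_agree => x; rewrite ldecK => xl.
  by apply: Hs => //; apply: leq_trans ll.
(* Up to [l0] the approximation judges derivations correctly, so the search selects [l0]. *)
have -> : diag_digit i c = (entry c c 1 \in ldec l0).
  apply/hasP/idP => [[l lin /and3P[Hl /allP Hk el]]|el].
    case: (ltngtP l l0) => [ll|ll|<- //].
      have := minl0 l; rewrite -hE; last exact: ltnW.
      by move=> /(_ Hl); rewrite leqNgt ll.
    by have := Hk l0; rewrite mem_iota ll hE // Hl0 => /(_ isT).
  exists l0; first by rewrite mem_iota.
  rewrite hE // Hl0 el andbT /=; apply/allP => k; rewrite mem_iota => /= kl.
  rewrite hE; last exact: ltnW.
  by apply/negP => /minl0; rewrite leqNgt kl.
have [vl _ /hasP[u ul /andP[/eqP uE u0]]] := and3P Hl0.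
have out w : entry c c w.+1 \in ldec l0 -> w = g c.
  move=> wl; apply: (@code_eval_det (jump zero_deg) d c) => //.
  have [|_] := @derivable_sound (jump zero_deg) (entry c c w.+1).
    by exists (ldec l0).
  by rewrite !entryE => /(_ d w erefl erefl).
apply/idP/idP => [/out|]; first by case: (g c).
move=> gc; have := out (sndn (sndn u)).-1; rewrite prednK // -uE => /(_ ul).
rewrite (negbTE gc) => w0; suff <- : u = entry c c 1 by [].
by rewrite uE -(prednK u0) w0.
Qed.

(** At some [c] the digits tend to the negation of [g c], and [v <= f v] makes the stages along [f]
    large. *)
Lemma no_limit_digits (f : nat -> nat) (g : nat -> bool) :
  (forall v, v <= f v) ->
  (forall e, exists s, forall v, s <= v -> diag_digit (f v) e = g e) ->
  ~ decidable_in (jump zero_deg) g.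
Proof.
move=> vf lim /diag_digitP[c [i0 Hi]]; have [s Hs] := lim c.
have := Hs (maxn s i0); rewrite leq_maxl => /(_ isT).
rewrite Hi; first by case: (g c).
exact: leq_trans (leq_maxr s i0) (vf _).
Qed.

(** * Base 4 expansions and the diagonal sequence *)

Local Open Scope ring_scope.

Definition expansion (R : realType) (N : nat) (u : nat -> bool) : R :=
  \sum_(e < N) (u e)%:R / 4 ^+ e.

Lemma expansionS (R : realType) N u :
  expansion R N.+1 u = (u 0%N)%:R + expansion R N (fun e => u e.+1) / 4.
Proof.
rewrite /expansion big_ord_recl expr0 divr1; congr (_ + _); rewrite mulr_suml.
by apply: eq_bigr => e _; rewrite exprSr invfM mulrA.
Qed.

(** [4 / 3] is the sum of the geometric series of ratio [1 / 4], a fixed point of adding a leading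
    digit 1. *)
Lemma expansion_bound (R : realType) N u : 0 <= expansion R N u <= 4 / 3.
Proof.
elim: N u => [|N IH] u; first by rewrite /expansion big_ord0; apply/andP; split; lra.
rewrite expansionS; have /andP[] := IH (fun e => u e.+1).
by move=> p0 p1; case: (u 0%N) => /=; apply/andP; split; lra.
Qed.

Lemma expansion_widen (R : realType) i N u : (i <= N)%N ->
  (forall e, (i <= e)%N -> u e = false) -> expansion R N u = expansion R i u.
Proof.
move=> + u0; elim: N => [|N IH]; first by rewrite leqn0 => /eqP ->.
rewrite leq_eqVlt => /orP[/eqP -> //|iN].
by rewrite -(IH iN) /expansion big_ord_recr /= u0 // mul0r addr0.
Qed.

(** Tails contribute at most [1 / 3], so distinct leading digits keep the values [2 / 3] apart, more
    than [1 / 2]. Equal ones cancel, and each further digit costs a factor 4. *)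
Lemma expansion_close (R : realType) k N u v : (k < N)%N ->
  `|expansion R N u - expansion R N v| < 2 ^- (2 * k + 1) ->
  forall j, (j <= k)%N -> u j = v j.
Proof.
elim: k N u v => [|k IH] [|N] u v // kN; rewrite !expansionS.
all: have /andP[a1 a2] := expansion_bound R N (fun e => u e.+1).
all: have /andP[b1 b2] := expansion_bound R N (fun e => v e.+1).
  rewrite muln0 add0n expr1 ltr_norml => /andP[c1 c2] j; rewrite leqn0 => /eqP ->.
  by move: c1 c2; case: (u 0%N); case: (v 0%N) => //=; lra.
have pE : (2 : R) ^- (2 * k.+1 + 1) = 2 ^- (2 * k + 1) / 4.
  have -> : (2 * k.+1 + 1 = (2 * k + 1).+2)%N by lia.
  by rewrite !exprS; field; rewrite expf_neq0.
have p1 : (2 : R) ^- (2 * k + 1) <= 1.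
  by rewrite invf_le1 ?exprn_gt0 // exprn_ege1 // ler1n.
rewrite pE ltr_norml => /andP[c1 c2].
have uv0 : u 0%N = v 0%N by move: c1 c2; case: (u 0%N); case: (v 0%N) => //=; lra.
have close : `|expansion R N (fun e => u e.+1) - expansion R N (fun e => v e.+1)|
    < 2 ^- (2 * k + 1).
  by move: c1 c2; rewrite uv0 ltr_norml => c1 c2; apply/andP; split; lra.
by case=> [//|j] jk; apply: (IH N _ _ kN close).
Qed.

Definition diag_seq (R : realType) (i : nat) : R := expansion R i (diag_digit i).

Lemma diag_seq_close (R : realType) e i j :
  `|diag_seq R i - diag_seq R j| < 2 ^- (2 * e + 1) -> diag_digit i e = diag_digit j e.
Proof.
(* A common length for both expansions, large enough to include digit [e]. *)
pose N := (maxn (maxn i j) e.+1).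
have wid k : (k <= N)%N -> diag_seq R k = expansion R N (diag_digit k).
  move=> kN; rewrite /diag_seq (expansion_widen _ kN) // => c kc.
  exact: diag_digit_ge.
rewrite !wid; try by rewrite /N; lia.
by move=> /expansion_close; apply; rewrite // /N; lia.
Qed.

Lemma diag_seq_bounded (R : realType) : bounded_fun (diag_seq R).
Proof.
exists (4 / 3); split=> [|M ltM i _ /=]; first exact: num_real.
have /andP[p0 p1] := expansion_bound R i (diag_digit i).
by rewrite ger0_norm // (le_trans p1) // ltW.
Qed.

(** Term [i] is a rational with denominator [4 ^ i], so its exact name serves every precision. *)
Lemma diag_seq_recursive (R : realType) : recursive_seq (diag_seq R).
Proof.
pose num i N := iteri N (fun e z => z + diag_digit i e * 4 ^ (i - e))%N 0%N.
exists (fun p => pairn (num (fstn p) (fstn p)) (pairn 0 (4 ^ fstn p).-1)).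
  rewrite /num /computable; have cd := dec_diag_digit (comp_oracle zero_deg).
  by comp.
move=> i k; rewrite !pairE /rat_of_nat !pairE prednK ?expn_gt0 //.
rewrite fmorph_div rmorphB /= !ratr_nat subr0.
suff numE N : (N <= i)%N -> (num i N)%:R = expansion R N (diag_digit i) * 4 ^+ i.
  rewrite numE // natrX mulfK ?expf_neq0 ?pnatr_eq0 //.
  by rewrite subrr normr0 invr_ge0 exprn_ge0.
elim: N => [|N IH] Ni; first by rewrite /expansion big_ord0 mul0r.
rewrite /num /= -/(num i N) natrD IH 1?ltnW // /expansion big_ord_recr /= mulrDl.
congr (_ + _); rewrite natrM natrX -mulrA; congr (_ * _).
by rewrite -[in RHS](subnK (ltnW Ni)) exprD mulrCA mulVf ?expf_neq0 ?pnatr_eq0 // mulr1.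
Qed.

Lemma leq_increasing (f : nat -> nat) v : increasing_seq f -> (v <= f v)%N.
Proof.
move=> fi; elim: v => // v IH; apply: leq_ltn_trans IH _.
by rewrite ltnNge; have := fi v.+1 v; rewrite leEnat => ->; rewrite ltnn.
Qed.

(** Fast convergence settles digit [e] from index [2 * e + 1] on, so the limit digit is computed
    directly from [f]. *)
Lemma diag_seq_no_fast (R : realType) (f : nat -> nat) :
  increasing_seq f -> computable_in (jump zero_deg) f -> ~ fast_subseq (diag_seq R) f.
Proof.
move=> fi cf fast.
apply: (@no_limit_digits f (fun e => diag_digit (f (2 * e + 1)%N) e)).
- by move=> v; apply: leq_increasing.
- move=> e; exists (2 * e + 1)%N => v ev; apply: (@diag_seq_close R).
  exact: fast.
- have cd := dec_diag_digit (comp_const (jump zero_deg) 0).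
  by comp.
Qed.

(** No modulus is given, but for computable [f] stability of a digit from [s] on is a universal
    statement, so [0'] can search for the first such [s]. *)
Lemma diag_seq_no_cauchy (R : realType) (f : nat -> nat) :
  increasing_seq f -> computable f -> ~ cauchy_subseq (diag_seq R) f.
Proof.
move=> fi cf cauchy.
pose stable e s :=
  `[< forall v, (s <= v)%N ==> (diag_digit (f v) e == diag_digit (f s) e) >].
have ex_stable e : exists s, stable e s.
  have [s Hs] := cauchy (2 * e + 1)%N; exists s; apply/asboolP => v; apply/implyP => sv.
  by apply/eqP/(@diag_seq_close R); apply: Hs.
have cd := dec_diag_digit (comp_oracle zero_deg).
have cs : decidable_in (jump zero_deg) (fun p => stable (fstn p) (sndn p)).
  apply: (@sigma1_compl_jump _ (fun p v => (sndn p <= v)%N ==>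
    (diag_digit (f v) (fstn p) == diag_digit (f (sndn p)) (fstn p)))).
  by rewrite /computable in cf; comp.
pose s e := ex_minn (ex_stable e).
have cm : computable_in (jump zero_deg) s by apply: comp_ex_minn.
apply: (@no_limit_digits f (fun e => diag_digit (f (s e)) e)).
- by move=> v; apply: leq_increasing.
- move=> e; exists (s e) => v; rewrite /s; case: ex_minnP => m /asboolP Hm _ mv.
  by have /implyP/(_ mv)/eqP := Hm v.
- have cd' := comp_jumpW cd; have cf' := comp_jumpW cf.
  by clearbody s; clear ex_stable cs cd cf; comp.
Qed.

Theorem theorem11 (R : realType) :
  (forall x : nat -> R, recursive_seq x -> bounded_fun x ->
     exists f : nat -> nat,
       [/\ increasing_seq f, low2 f & cauchy_subseq x f]) /\
  (exists x : nat -> R, [/\ recursive_seq x, bounded_fun x &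
     ~ exists f : nat -> nat,
       [/\ increasing_seq f, computable f & cauchy_subseq x f]]) /\
  (exists x : nat -> R, [/\ recursive_seq x, bounded_fun x &
     ~ exists f : nat -> nat,
       [/\ increasing_seq f, computable_in (jump zero_deg) f
         & fast_subseq x f]]).
Proof.
split; [exact: low2_cauchy_subseq|split]; exists (diag_seq R); split.
- exact: diag_seq_recursive.
- exact: diag_seq_bounded.
- by move=> [f [fi cf]]; apply: diag_seq_no_cauchy.
- exact: diag_seq_recursive.
- exact: diag_seq_bounded.
- by move=> [f [fi cf]]; apply: diag_seq_no_fast.
Qed.
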